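(* Let $G$ be a Kazhdan group. Suppose that $G$ admits a sofic embedding $\pi:G\to\mathcal S_{\mathcal U}$ into a universal sofic group $\mathcal S_{\mathcal U}=\prod_{\mathcal U}\mathrm{Sym}(n)$, for some non-principal ultrafilter $\mathcal U$ on $\mathbb N$, such that the centralizer $C_{\mathcal S_{\mathcal U}}(\pi(G))$ acts ergodically on the associated Loeb probability space. Then $G$ is locally embeddable into finite groups (LEF). In particular, if $G$ is finitely presented, then $G$ is residually finite.
   Context: A Kazhdan group is a discrete group with Kazhdan's property (T); such a group is finitely generated. For a finite set $X$, the normalized Hamming distance on $\mathrm{Sym}(X)$ is $d_H(\sigma,\tau)=|\{x\in X:\sigma x\ne\tau x\}|/|X|$. For a non-principal ultrafilter $\mathcal U$ on $\mathbb N$, the universal sofic group $\mathcal S_{\mathcal U}=\prod_{\mathcal U}\mathrm{Sym}(n)$ is the metric ultraproduct: the quotient of $\prod_n\mathrm{Sym}(n)$ by the normal subgroup of sequences $(\sigma_n)$ with $\lim_{n\to\mathcal U}d_H(\sigma_n,1)=0$, where $\mathrm{Sym}(n)=\mathrm{Sym}(\{1,\dots,n\})$. It carries the bi-invariant metric $d([\sigma_n]_{\mathcal U},[\tau_n]_{\mathcal U})=\lim_{n\to\mathcal U}d_H(\sigma_n,\tau_n)$. A sofic embedding $\pi:G\to\mathcal S_{\mathcal U}$ is a homomorphism with $d(\pi(g),1)=1$ for every $g\neq e$ (i.e. it is induced by a sofic approximation of $G$ along $\mathcal U$). The associated Loeb probability space $(X,\mu)$ is the ultraproduct along $\mathcal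 U$ of the sets $\{1,\dots,n\}$ with normalized counting measures $\mu_n$: $X$ is the set-theoretic ultraproduct, and $\mu$ is the Loeb measure determined by $\mu([Y_n]_{\mathcal U})=\lim_{n\to\mathcal U}|Y_n|/n$ for internal sets $[Y_n]_{\mathcal U}$. The group $\mathcal S_{\mathcal U}$ acts on $(X,\mu)$ by measure-preserving transformations (modulo null sets) via $[\sigma_n]_{\mathcal U}[x_n]_{\mathcal U}=[\sigma_nx_n]_{\mathcal U}$. A subgroup $A\le\mathcal S_{\mathcal U}$ acts ergodically if every measurable $Y\subseteq X$ with $\mu(aY\triangle Y)=0$ for all $a\in A$ has $\mu(Y)\in\{0,1\}$. A finitely generated group $G$ is locally embeddable into finite groups (LEF) if for every finite set $E\subseteq G$ there are a finite group $K$ and an injective map $\theta:E\to K$ such that $\theta(xy)=\theta(x)\theta(y)$ whenever $x,y,xy\in E$. *)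

(* Defs.v *)
From HB Require Import structures.
From mathcomp Require Import all_fingroup.
From mathcomp Require Import all_boot all_order all_algebra.
From mathcomp Require Import all_classical all_reals all_analysis.
From mathcomp.real_closed Require Import complex.

Set Implicit Arguments.
Unset Strict Implicit.
Unset Printing Implicit Defensive.

Import Order.TTheory GRing.Theory Num.Theory.
Import numFieldNormedType.Exports.

Local Open Scope classical_set_scope.
Local Open Scope ring_scope.
Local Open Scope quotient_scope.

Definition inner_norm (R : realType) (V : lmodType R[i])
    (inner : {dot V for Num.Def.conjC}) (v : V) : R :=
  Num.sqrt (complex.Re (inner v v)).

Record hilbertType (R : realType) := HilbertType {
  hilbert_sort :> lmodType R[i];
  inner : {dot hilbert_sort for Num.Def.conjC};
  hilbert_complete : forall u : nat -> hilbert_sort,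
    (forall e : R, 0 < e ->
      \forall m & n \near \oo, inner_norm inner (u m - u n) < e) ->
    exists l : hilbert_sort, inner_norm inner (u n - l) @[n --> \oo] --> (0 : R)
}.

Definition hnorm (R : realType) (V : hilbertType R) (v : V) : R :=
  inner_norm (inner V) v.

Record unitary_rep (R : realType) (G : groupType) (V : hilbertType R) :=
  UnitaryRep {
    rep :> G -> {linear V -> V};
    rep1 : forall v, rep 1%g v = v;
    repM : forall g h v, rep (g * h)%g v = rep g (rep h v);
    rep_inner : forall g v w, inner V (rep g v) (rep g w) = inner V v w
  }.

(* The compact subsets of a discrete group are the finite ones. *)
Definition property_T (R : realType) (G : groupType) : Prop :=
  exists (Q : seq G) (eps : R), 0 < eps /\
    forall (V : hilbertType R) (rho : unitary_rep G V),
      (exists v : V, v != 0 /\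
         forall g, g \in Q -> hnorm (rho g v - v) < eps * hnorm v) ->
      exists v : V, v != 0 /\ forall g, rho g v = v.

(* Only the restriction of theta to E matters; any map E -> K extends to G. *)
Definition LEF (G : groupType) : Prop :=
  forall E : set G, finite_set E ->
    exists (K : finGroupType) (theta : G -> K),
      {in E &, injective theta} /\
      forall x y, E x -> E y -> E (x * y)%g ->
        theta (x * y)%g = (theta x * theta y)%g.

Definition residually_finite (G : groupType) : Prop :=
  forall g : G, g <> 1%g ->
    exists (K : finGroupType) (f : {multiplicative G -> K}), f g <> 1%g.

(* The letter (i, false) is the i-th generator, (i, true) its inverse. *)
Definition word (n : nat) := seq ('I_n * bool).

Definition eval_word (G : groupType) (n : nat) (gen : 'I_n -> G) (w : word n) : G :=
  (\prod_(l <- w) (if l.2 then (gen l.1)^-1 else gen l.1))%g.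

(* The quotient of words by this congruence is the group <x_1..x_n | rels>. *)
Inductive presentation_eq (n : nat) (rels : seq (word n)) :
    word n -> word n -> Prop :=
  | pres_refl w : presentation_eq rels w w
  | pres_sym u v : presentation_eq rels u v -> presentation_eq rels v u
  | pres_trans u v w :
      presentation_eq rels u v -> presentation_eq rels v w ->
      presentation_eq rels u w
  | pres_cat u u' v v' :
      presentation_eq rels u u' -> presentation_eq rels v v' ->
      presentation_eq rels (u ++ v) (u' ++ v')
  | pres_cancel i b : presentation_eq rels [:: (i, b); (i, ~~ b)] [::]
  | pres_rel r : r \in rels -> presentation_eq rels r [::].

Definition finitely_presented (G : groupType) : Prop :=
  exists (n : nat) (rels : seq (word n)) (gen : 'I_n -> G),
    (forall g, exists w, eval_word gen w = g) /\
    (forall u v, eval_word gen u = eval_word gen v <-> presentation_eq rels u v).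

Record npUltrafilter := NpUltrafilter {
  ufilter :> set_system nat;
  ufilter_ultra : UltraFilter ufilter;
  ufilter_nonprincipal : forall n, ~ ufilter [set n]
}.

#[global] Existing Instance ufilter_ultra.

Definition ulim (R : realType) (U : npUltrafilter) (f : nat -> R) : R :=
  lim (f @ ufilter U).

Section Ultralimit.
Variables (R : realType) (U : npUltrafilter).
Implicit Types f g : nat -> R.

Lemma ufN (A : set nat) : ~ ufilter U A <-> ufilter U (~` A).
Proof.
split; first by case: (@in_ultra_setVsetC _ (ufilter U) A _).
move=> UnA UA; apply: (@filter_not_empty _ (ufilter U)).
by rewrite -(setICr A); exact: filterI.
Qed.

Lemma uf_ge N : \forall n \near ufilter U, (N <= n)%N.
Proof.
elim: N => [|N IH]; first by near=> n.
have /ufN UN := @ufilter_nonprincipal U N.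
apply: filterS2 IH UN => n; rewrite leq_eqVlt => /orP[/eqP <-|//].
by case.
Unshelve. all: by end_near. Qed.

Lemma ulim_cvg f (a b : R) : (forall n, a <= f n <= b) ->
  f @ ufilter U --> ulim U f.
Proof.
move=> fab; apply/cvg_ex => /=.
have := @segment_compact R a b (f @ ufilter U) _.
case=> [|p [_ clp]].
  by apply: nearW => n; rewrite /= in_itv /=; exact: fab.
exists p => A pA.
case: (@in_ultra_setVsetC _ (ufilter U) (f @^-1` A) _) => // UnA.
have [y [nAy Ay]] := clp (~` A) A UnA pA.
by [].
Qed.

Lemma ulim_near f (l : R) :
  (\forall n \near ufilter U, f n = l) -> ulim U f = l.
Proof. exact: lim_near_cst. Qed.

Lemma ulimD f g (a b c d : R) :
  (forall n, a <= f n <= b) -> (forall n, c <= g n <= d) ->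
  ulim U (fun n => f n + g n) = ulim U f + ulim U g.
Proof.
by move=> /ulim_cvg fab /ulim_cvg gcd; apply: cvg_lim => //; exact: cvgD.
Qed.

Lemma ulim_le f g (a b c d : R) :
  (forall n, a <= f n <= b) -> (forall n, c <= g n <= d) ->
  (\forall n \near ufilter U, f n <= g n) -> ulim U f <= ulim U g.
Proof. move=> /ulim_cvg fab /ulim_cvg gcd; exact: ler_cvg_to. Qed.

Lemma ulim_eq f g (a b c d : R) :
  (forall n, a <= f n <= b) -> (forall n, c <= g n <= d) ->
  (\forall n \near ufilter U, f n = g n) -> ulim U f = ulim U g.
Proof.
move=> fab gcd fg; apply/eqP; rewrite eq_le; apply/andP; split.
  by apply: (ulim_le fab gcd); apply: filterS fg => n ->.
by apply: (ulim_le gcd fab); apply: filterS fg => n ->.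
Qed.

Lemma ulim_ge0 f (b : R) : (forall n, 0 <= f n <= b) -> 0 <= ulim U f.
Proof.
move=> fb; rewrite -(ulim_near (f := fun=> 0) (l := 0)); last by near=> n.
apply: (@ulim_le _ _ 0 0 0 b) => // [n|]; first by rewrite lexx.
by near=> n; case/andP: (fb n).
Unshelve. all: by end_near. Qed.

Lemma ulim_eq0D f g h (a b c : R) :
  (forall n, 0 <= f n <= a) -> (forall n, 0 <= g n <= b) ->
  (forall n, 0 <= h n <= c) -> (forall n, h n <= f n + g n) ->
  ulim U f = 0 -> ulim U g = 0 -> ulim U h = 0.
Proof.
move=> fa gb hc hfg f0 g0; apply/eqP; rewrite eq_le (ulim_ge0 hc) andbT.
have -> : 0 = ulim U (fun n => f n + g n) by rewrite (ulimD fa gb) f0 g0 addr0.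
apply: (@ulim_le _ _ 0 c 0 (a + b)) => // [n|]; last by near=> n; exact: hfg.
by have /andP[? ?] := fa n; have /andP[? ?] := gb n; rewrite addr_ge0// lerD.
Unshelve. all: by end_near. Qed.

End Ultralimit.

Definition hamming (R : realType) (n : nat) (s t : {perm 'I_n}) : R :=
  #|[pred x | s x != t x]|%:R / n%:R.

Section Hamming.
Variables (R : realType) (n : nat).
Implicit Types s t u : {perm 'I_n}.
Local Notation d := (@hamming R n).

Lemma hamming_bnd s t : 0 <= d s t <= 1.
Proof.
rewrite divr_ge0 ?ler0n//=; case: n s t => [|m] s t.
  by rewrite /hamming invr0 mulr0.
by rewrite ler_pdivrMr ?ltr0n// mul1r ler_nat -[leqRHS]card_ord max_card.
Qed.

Lemma hammingxx s : d s s = 0.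
Proof. by rewrite /hamming eq_card0 ?mul0r// => x; rewrite !inE eqxx. Qed.

Lemma hammingC s t : d s t = d t s.
Proof. by congr (_%:R / _); apply: eq_card => x; rewrite !inE eq_sym. Qed.

Lemma hamming_triangle t s u : d s u <= d s t + d t u.
Proof.
rewrite -mulrDl ler_wpM2r ?invr_ge0 ?ler0n// -natrD ler_nat -cardUI.
apply: leq_trans (leq_addr _ _); apply/subset_leq_card/fintype.subsetP => x.
by rewrite !inE; apply: contraR; rewrite negb_or !negbK => /andP[/eqP-> /eqP->].
Qed.

Lemma hamming_mull u s t : d (u * s)%g (u * t)%g = d s t.
Proof.
rewrite /hamming.
have -> : #|[pred x | (u * s)%g x != (u * t)%g x]|
          = #|[preim u of [pred x | s x != t x]]|.
  by apply: eq_card => x; rewrite !inE !permM.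
rewrite card_preim; last exact: perm_inj.
congr (_%:R / _); apply: eq_card => x; rewrite !inE; case: eqP => /= _; first by rewrite andbF.
by rewrite andbT; apply/codomP; exists (u^-1%g x); rewrite permKV.
Qed.

Lemma hamming_mulr u s t : d (s * u)%g (t * u)%g = d s t.
Proof.
by congr (_%:R / _); apply: eq_card => x; rewrite !inE !permM (inj_eq perm_inj).
Qed.

Lemma hamming_inv s t : d s^-1%g t^-1%g = d s t.
Proof.
by rewrite -(hamming_mull s) mulgV -(hamming_mulr t) mul1g mulgKV hammingC.
Qed.

End Hamming.

(* Index n carries Sym(n+1) and {0, .., n}: the index set {1, 2, ..} is
   renumbered from 0, which avoids the empty set at n = 0. *)
Definition perm_seq := forall n : nat, {perm 'I_n.+1}.
HB.instance Definition _ := gen_eqMixin perm_seq.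
HB.instance Definition _ := gen_choiceMixin perm_seq.

(* In {perm T} the product s * t applies s first; here permutations compose as
   functions, (s t) x = s (t x). *)
Definition mul_seq (s t : perm_seq) : perm_seq := fun n => (t n * s n)%g.
Definition one_seq : perm_seq := fun=> 1%g.
Definition inv_seq (s : perm_seq) : perm_seq := fun n => (s n)^-1%g.

Section SoficGroup.
Variables (R : realType) (U : npUltrafilter).
Implicit Types s t u : perm_seq.

Definition dist_seq s t : R := ulim U (fun n => hamming R (s n) (t n)).

(* By invariance of the Hamming distance, this is congruence modulo the normal
   subgroup of the sequences at ultralimit distance 0 from the identity; see
   sofic_relE. *)
Definition sofic_rel s t : bool := dist_seq s t == 0.

Lemma dist_seqxx s : dist_seq s s = 0.
Proof. by apply: ulim_near; near=> n; rewrite hammingxx. Unshelve. all: by end_near. Qed.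

Lemma dist_seqC s t : dist_seq s t = dist_seq t s.
Proof. by congr ulim; apply/funext => n; rewrite hammingC. Qed.

Lemma dist_seq_triangle t s u : dist_seq s u <= dist_seq s t + dist_seq t u.
Proof.
have b s' t' n : 0 <= hamming R (s' n) (t' n) <= 1 by exact: hamming_bnd.
rewrite /dist_seq -(ulimD U (b s t) (b t u)).
apply: (@ulim_le _ _ _ _ 0 1 0 2) => [n|n|]; first exact: b.
  have /andP[? ?] := b s t n; have /andP[? ?] := b t u n.
  by rewrite addr_ge0//= -[2]/(1 + 1) lerD.
by near=> n; exact: hamming_triangle.
Unshelve. all: by end_near. Qed.

Lemma dist_seq_ge0 s t : 0 <= dist_seq s t.
Proof. by apply: (@ulim_ge0 _ _ _ 1) => n; exact: hamming_bnd. Qed.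

Lemma sofic_refl : reflexive sofic_rel.
Proof. by move=> s; rewrite /sofic_rel dist_seqxx. Qed.

Lemma sofic_sym : symmetric sofic_rel.
Proof. by move=> s t; rewrite /sofic_rel dist_seqC. Qed.

Lemma sofic_trans : transitive sofic_rel.
Proof.
move=> t s u /eqP st /eqP tu; rewrite /sofic_rel eq_le dist_seq_ge0 andbT.
by rewrite (le_trans (dist_seq_triangle t s u))// st tu addr0.
Qed.

Canonical sofic_equiv := EquivRel sofic_rel sofic_refl sofic_sym sofic_trans.

Lemma sofic_relE s t :
  sofic_rel s t = (dist_seq (mul_seq (inv_seq s) t) one_seq == 0).
Proof.
congr (_ == _); rewrite dist_seqC; congr ulim; apply/funext => n.
by rewrite -[RHS](hamming_mulr R (s n)) mul1g mulgKV.
Qed.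

Definition sofic_group := {eq_quot sofic_equiv}.
HB.instance Definition _ := Choice.on sofic_group.
HB.instance Definition _ := EqQuotient.on sofic_group.

Implicit Types a b c : sofic_group.

Definition sofic_mul a b : sofic_group := \pi_sofic_group (mul_seq (repr a) (repr b)).
Definition sofic_one : sofic_group := \pi_sofic_group one_seq.
Definition sofic_inv a : sofic_group := \pi_sofic_group (inv_seq (repr a)).

Definition sofic_dist a b : R := dist_seq (repr a) (repr b).

Lemma sofic_piP s t : \pi_sofic_group s = \pi_sofic_group t <-> dist_seq s t = 0.
Proof.
split; first by move/eqP; rewrite piE => /eqP.
by move=> st; apply/eqP; rewrite piE; apply/eqP.
Qed.

Lemma sofic_repr s : dist_seq (repr (\pi_sofic_group s)) s = 0.
Proof. by apply/sofic_piP; rewrite reprK. Qed.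

Lemma sofic_mul_pi s t :
  sofic_mul (\pi_sofic_group s) (\pi_sofic_group t) = \pi_sofic_group (mul_seq s t).
Proof.
apply/sofic_piP; set s' := repr _; set t' := repr _.
apply/eqP; rewrite eq_le dist_seq_ge0 andbT.
apply: (le_trans (dist_seq_triangle (mul_seq s' t) _ _)).
rewrite (_ : dist_seq _ (mul_seq s' t) = dist_seq t' t); last first.
  by congr ulim; apply/funext => n; rewrite hamming_mulr.
rewrite (_ : dist_seq (mul_seq s' t) _ = dist_seq s' s); last first.
  by congr ulim; apply/funext => n; rewrite hamming_mull.
by rewrite !sofic_repr addr0.
Qed.

Lemma sofic_inv_pi s : sofic_inv (\pi_sofic_group s) = \pi_sofic_group (inv_seq s).
Proof.
apply/sofic_piP; rewrite -[RHS](sofic_repr s).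
by congr ulim; apply/funext => n; rewrite hamming_inv.
Qed.

Lemma sofic_dist_pi s t :
  sofic_dist (\pi_sofic_group s) (\pi_sofic_group t) = dist_seq s t.
Proof.
apply/eqP; rewrite eq_le; apply/andP; split.
  apply: (le_trans (dist_seq_triangle s _ _)); rewrite sofic_repr add0r.
  apply: (le_trans (dist_seq_triangle t _ _)).
  by rewrite (dist_seqC t) sofic_repr addr0.
apply: (le_trans (dist_seq_triangle (repr (\pi_sofic_group s)) _ _)).
rewrite dist_seqC sofic_repr add0r.
apply: (le_trans (dist_seq_triangle (repr (\pi_sofic_group t)) _ _)).
by rewrite sofic_repr addr0.
Qed.

Lemma sofic_mulA : associative sofic_mul.
Proof.
elim/quotW=> a; elim/quotW=> b; elim/quotW=> c.
rewrite (sofic_mul_pi a b) (sofic_mul_pi b c) !sofic_mul_pi.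
apply: (congr1 \pi_sofic_group); apply: functional_extensionality_dep => n.
by rewrite /mul_seq mulgA.
Qed.

Lemma sofic_mul1 : left_id sofic_one sofic_mul.
Proof.
elim/quotW=> a; rewrite sofic_mul_pi.
apply: (congr1 \pi_sofic_group); apply: functional_extensionality_dep => n.
by rewrite /mul_seq mulg1.
Qed.

Lemma sofic_1mul : right_id sofic_one sofic_mul.
Proof.
elim/quotW=> a; rewrite sofic_mul_pi.
apply: (congr1 \pi_sofic_group); apply: functional_extensionality_dep => n.
by rewrite /mul_seq mul1g.
Qed.

Lemma sofic_mulV : left_inverse sofic_one sofic_inv sofic_mul.
Proof.
elim/quotW=> a; rewrite sofic_inv_pi sofic_mul_pi.
apply: (congr1 \pi_sofic_group); apply: functional_extensionality_dep => n.
by rewrite /mul_seq mulgV.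
Qed.

Lemma sofic_Vmul : right_inverse sofic_one sofic_inv sofic_mul.
Proof.
elim/quotW=> a; rewrite sofic_inv_pi sofic_mul_pi.
apply: (congr1 \pi_sofic_group); apply: functional_extensionality_dep => n.
by rewrite /mul_seq mulVg.
Qed.

HB.instance Definition _ := isGroup.Build sofic_group
  sofic_mulA sofic_mul1 sofic_1mul sofic_mulV sofic_Vmul.

End SoficGroup.

Definition sofic_embedding (R : realType) (U : npUltrafilter) (G : groupType)
    (pi : {multiplicative G -> sofic_group R U}) : Prop :=
  forall g : G, g <> 1%g -> sofic_dist (pi g) 1%g = 1.

Definition centralizer (H : groupType) (A : set H) : set H :=
  [set c | forall a, A a -> (c * a = a * c)%g].

Definition point_seq := forall n : nat, 'I_n.+1.
HB.instance Definition _ := gen_eqMixin point_seq.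
HB.instance Definition _ := gen_choiceMixin point_seq.

Section LoebSpace.
Variable U : npUltrafilter.
Implicit Types x y z : point_seq.

Definition loeb_rel x y : bool := `[< \forall n \near ufilter U, x n = y n >].

Lemma loeb_refl : reflexive loeb_rel.
Proof. by move=> x; apply/asboolP; near=> n. Unshelve. all: by end_near. Qed.

Lemma loeb_sym : symmetric loeb_rel.
Proof. by move=> x y; apply/asboolP/asboolP; apply: filterS => n ->. Qed.

Lemma loeb_trans : transitive loeb_rel.
Proof.
move=> y x z /asboolP xy /asboolP yz; apply/asboolP.
by apply: filterS2 xy yz => n -> ->.
Qed.

Canonical loeb_equiv := EquivRel loeb_rel loeb_refl loeb_sym loeb_trans.

Definition loeb_space := {eq_quot loeb_equiv}.
HB.instance Definition _ := Choice.on loeb_space.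
HB.instance Definition _ := EqQuotient.on loeb_space.
HB.instance Definition _ := isPointed.Build loeb_space (\pi_loeb_space (fun=> ord0)).

Lemma loeb_piP x y : \pi_loeb_space x = \pi_loeb_space y <->
  \forall n \near ufilter U, x n = y n.
Proof.
split; first by move/eqP; rewrite piE => /asboolP.
by move=> xy; apply/eqP; rewrite piE; apply/asboolP.
Qed.

Definition internal (Y : forall n, {set 'I_n.+1}) : set loeb_space :=
  [set \pi_loeb_space x | x in
    [set x : point_seq | \forall n \near ufilter U, x n \in Y n]].

Lemma internal_pi Y x :
  internal Y (\pi_loeb_space x) <-> \forall n \near ufilter U, x n \in Y n.
Proof.
split; last by move=> xY; exists x.
by case=> y yY /loeb_piP yx; apply: filterS2 yY yx => n + <-.
Qed.

Lemma internal_sub Y Z :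
  internal Y `<=` internal Z <-> \forall n \near ufilter U, Y n \subset Z n.
Proof.
split=> [YZ|YZ _ [x xY <-]]; last first.
  apply/internal_pi; apply: filterS2 xY YZ => n xn /fintype.subsetP; exact.
apply: contrapT => /ufN nYZ.
pose x : point_seq := fun n => odflt ord0 [pick i in Y n :\: Z n].
have xP n : ~ Y n \subset Z n -> x n \in Y n :\: Z n.
  move=> /negP/subsetPn[i iY iZ]; rewrite /x; case: pickP => //= /(_ i).
  by rewrite inE iZ iY.
have /YZ /internal_pi xZ : internal Y (\pi_loeb_space x).
  by apply/internal_pi; apply: filterS nYZ => n /xP; rewrite inE => /andP[].
apply: (@filter_not_empty _ (ufilter U)).
apply: filterS2 nYZ xZ => n /xP; rewrite inE => /andP[/negP].
by [].
Qed.

Lemma internal_eq Y Z :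
  internal Y = internal Z <-> \forall n \near ufilter U, Y n = Z n.
Proof.
split=> [YZ|YZ].
  have /internal_sub YZ1 : internal Y `<=` internal Z by rewrite YZ.
  have /internal_sub YZ2 : internal Z `<=` internal Y by rewrite YZ.
  by apply: filterS2 YZ1 YZ2 => n ? ?; apply/eqP; rewrite finset.eqEsubset; apply/andP.
by apply/seteqP; split; apply/internal_sub; apply: filterS YZ => n ->.
Qed.

Lemma internal0 : internal (fun=> finset.set0) = set0.
Proof.
rewrite -subset0 => a [x h _]; apply: (@filter_not_empty _ (ufilter U)).
by apply: filterS h => n; rewrite inE.
Qed.

Lemma internalT : internal (fun=> finset.setTfor _) = setT.
Proof.
apply/seteqP; split=> // a _; rewrite -[a]reprK; apply/internal_pi.
by near=> n; rewrite inE.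
Unshelve. all: by end_near. Qed.

Lemma internalU Y Z :
  internal Y `|` internal Z = internal (fun n => finset.setU (Y n) (Z n)).
Proof.
apply/seteqP; split=> a; rewrite -[a]reprK.
  by case=> /internal_pi aY; apply/internal_pi; apply: filterS aY => n aY;
    rewrite inE aY ?orbT.
move=> /internal_pi aYZ.
case: (@in_ultra_setVsetC _ (ufilter U) [set n | repr a n \in Y n] _) => aY.
  by left; apply/internal_pi.
right; apply/internal_pi; apply: filterS2 aYZ aY => n.
by rewrite inE => /orP[aYn nY|//]; case: nY.
Qed.

Lemma internalC Y : ~` internal Y = internal (fun n => finset.setC (Y n)).
Proof.
apply/seteqP; split=> a; rewrite -[a]reprK.
  move=> naY; apply/internal_pi.
  have /ufN : ~ ufilter U [set n | repr a n \in Y n] by move/internal_pi.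
  by apply: filterS => n /= /negP; rewrite inE.
move=> /internal_pi aYC /internal_pi aY.
apply: (@filter_not_empty _ (ufilter U)).
by apply: filterS2 aYC aY => n; rewrite inE => /negP.
Qed.

Definition loeb_display : measure_display. Proof. exact: default_measure_display. Qed.

Fact loeb_alg0 : range internal set0.
Proof. by exists (fun=> finset.set0); rewrite ?internal0. Qed.

Fact loeb_algU : setU_closed (range internal).
Proof.
by move=> _ _ [Y _ <-] [Z _ <-]; rewrite internalU; eexists.
Qed.

Fact loeb_algC : setC_closed (range internal).
Proof. by move=> _ [Y _ <-]; rewrite internalC; eexists. Qed.

HB.instance Definition _ := isAlgebraOfSets.Build loeb_display loeb_space
  loeb_alg0 loeb_algU loeb_algC.

Lemma internal_bigsetU (F : nat -> forall n, {set 'I_n.+1}) N :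
  internal (fun n => \bigcup_(i < N) F i n)%SET =
  \bigcup_(i < N) internal (F i).
Proof.
elim: N => [|N IH].
  rewrite bigcup_mkord big_ord0 -internal0; congr internal.
  by apply: functional_extensionality_dep => n; rewrite big_ord0.
rewrite bigcup_mkord big_ord_recr; move: IH; rewrite bigcup_mkord /= => <-.
rewrite internalU.
congr internal; apply: functional_extensionality_dep => n.
by rewrite big_ord_recr.
Qed.

(* Countable saturation: a countable cover of an internal set by internal sets
   has a finite subcover. *)
Lemma internal_bigcup (Y : forall n, {set 'I_n.+1})
    (F : nat -> forall n, {set 'I_n.+1}) :
  internal Y `<=` \bigcup_i internal (F i) ->
  exists N, internal Y `<=` \bigcup_(i < N) internal (F i).
Proof.
move=> YF; apply: contrapT => /forallNP nYF.
pose B N n : {set 'I_n.+1} := (Y n :\: \bigcup_(i < N) F i n)%SET.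
have Bdecr m N n : (N <= m)%N -> B m n \subset B N n.
  move=> Nm; apply: finset.setDS; apply/finset.bigcupsP => i _.
  exact: (finset.bigcup_sup (widen_ord Nm i)).
have B0 N : \forall n \near ufilter U, B N n != finset.set0.
  have : ~ ufilter U [set n | B N n == finset.set0].
    move=> BN0; apply: (nYF N); rewrite -internal_bigsetU.
    by apply/internal_sub; apply: filterS BN0 => n /=; rewrite /B finset.setD_eq0.
  by move/ufN; apply: filterS => n /negP.
have xB n m : exists x : 'I_n.+1,
    forall N, (N <= m)%N -> B N n != finset.set0 -> x \in B N n.
  elim: m => [|m [x xP]].
    have [B00|/finset.set0Pn[x xB]] := eqVneq (B 0%N n) finset.set0.
      by exists ord0 => N; rewrite leqn0 => /eqP ->; rewrite B00 eqxx.
    by exists x => N; rewrite leqn0 => /eqP ->.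
  have [Bm0|/finset.set0Pn[y yB]] := eqVneq (B m.+1 n) finset.set0.
    by exists x => N; rewrite leq_eqVlt ltnS => /orP[/eqP->|/xP//]; rewrite Bm0 eqxx.
  by exists y => N Nm _; apply: (fintype.subsetP (Bdecr _ _ _ Nm)).
pose x : point_seq := fun n => projT1 (cid (xB n n)).
have xP N : \forall n \near ufilter U, x n \in B N n.
  by apply: filterS2 (uf_ge U N) (B0 N) => n Nn BN; apply: (projT2 (cid (xB n n))).
have : internal Y (\pi_loeb_space x).
  by apply/internal_pi; apply: filterS (xP 0%N) => n; rewrite inE => /andP[].
move=> /YF[i _ /internal_pi xF]; apply: (@filter_not_empty _ (ufilter U)).
apply: filterS2 (xP i.+1) xF => n; rewrite inE => /andP[/negP + _] xFi; apply.
by apply/finset.bigcupP; exists ord_max.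
Qed.

End LoebSpace.

Arguments internal : clear implicits.

Section LoebMeasure.
Variables (R : realType) (U : npUltrafilter).
Implicit Types Y Z : forall n, {set 'I_n.+1}.
Local Notation X := (loeb_space U).

Definition density Y : R := ulim U (fun n => #|Y n|%:R / n.+1%:R).

Definition internal_rep (A : set X) : forall n, {set 'I_n.+1} :=
  xget (fun=> finset.set0) [set Y | internal U Y = A].

(* Only the values on internal sets matter. *)
Definition loeb_content (A : set X) : \bar R := (density (internal_rep A))%:E.

Lemma density_bnd Y n : 0 <= (#|Y n|%:R / n.+1%:R : R) <= 1.
Proof.
rewrite divr_ge0 ?ler0n//= ler_pdivrMr ?ltr0n// mul1r ler_nat.
by rewrite -[leqRHS]card_ord max_card.
Qed.

Lemma loeb_content_internal Y : loeb_content (internal U Y) = (density Y)%:E.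
Proof.
have /internal_eq YE : internal U (internal_rep (internal U Y)) = internal U Y.
  by rewrite /internal_rep; case: xgetP => [_ _ //|/(_ Y)]; case.
congr EFin; apply: ulim_eq (density_bnd _) (density_bnd _) _.
by apply: filterS YE => n ->.
Qed.

Fact loeb_content_ge0 A : (0 <= loeb_content A)%E.
Proof. by rewrite lee_fin; apply: ulim_ge0 => n; exact: density_bnd. Qed.

Fact loeb_content0 : loeb_content set0 = 0%E.
Proof.
rewrite -(internal0 U) loeb_content_internal; congr EFin.
by apply: ulim_near; near=> n; rewrite finset.cards0 mul0r.
Unshelve. all: by end_near. Qed.

Lemma loeb_contentU Y Z : internal U Y `&` internal U Z = set0 ->
  loeb_content (internal U Y `|` internal U Z) =
  (loeb_content (internal U Y) + loeb_content (internal U Z))%E.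
Proof.
move=> YZ0; rewrite internalU !loeb_content_internal -EFinD; congr EFin.
rewrite -(ulimD U (density_bnd Y) (density_bnd Z)).
apply: (ulim_eq (density_bnd _) (c := 0) (d := 2)) => [n|].
  have /andP[? ?] := density_bnd Y n; have /andP[? ?] := density_bnd Z n.
  by rewrite addr_ge0//= -[2]/(1 + 1) lerD.
have /internal_sub : internal U Y `<=` internal U (fun n => finset.setC (Z n)).
  by rewrite -internalC => a Ya Za; rewrite -[False]/(set0 a) -YZ0.
apply: filterS => n; rewrite -finset.disjoints_subset => YZn.
rewrite -mulrDl -natrD finset.cardsU.
by move: YZn; rewrite -finset.setI_eq0 => /eqP ->; rewrite finset.cards0 subn0.
Qed.

Fact loeb_content_sigma_additive : semi_sigma_additive loeb_content.
Proof.
move=> F mF tF [Y _ FY].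
have /choice[G GF] i : exists G, internal U G = F i by have [G _ <-] := mF i; exists G.
have addF n : (\sum_(0 <= i < n) loeb_content (F i))%E =
    loeb_content (\bigcup_(i < n) F i).
  elim: n => [|n IH].
    by rewrite big_geq// bigcup_mkord big_ord0 loeb_content0.
  have -> : \bigcup_(i < n.+1) F i = \bigcup_(i < n) F i `|` F n.
    by rewrite !bigcup_mkord big_ord_recr.
  rewrite big_nat_recr//= IH -GF.
  have UG : \bigcup_(i < n) F i =
      internal U (fun k => \bigcup_(i < n) G i k)%SET.
    by rewrite internal_bigsetU; apply: eq_bigcupr => i _; rewrite GF.
  rewrite UG loeb_contentU// -UG -subset0 => a [[i /= ni Fi]].
  rewrite GF => Fn; have /trivIsetP/(_ i n I I) := tF.
  rewrite neq_ltn ni => /(_ isT) FiFn.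
  by have : (F i `&` F n) a by []; rewrite FiFn.
have [N YN] : exists N, internal U Y `<=` \bigcup_(i < N) internal U (G i).
  apply: internal_bigcup; rewrite FY => a [i _ Fi]; exists i => //.
  by rewrite GF.
apply: cvg_near_cst; exists N => // n /= Nn; rewrite addF; congr loeb_content.
apply/seteqP; split=> [a [i _ Fi]|a]; first by exists i.
rewrite -FY => /YN[i /= iN]; rewrite GF => Fi; exists i => //=.
exact: leq_trans Nn.
Qed.

HB.instance Definition _ := isMeasure.Build _ X R loeb_content
  loeb_content0 loeb_content_ge0 loeb_content_sigma_additive.

(* The Loeb measure, on the sigma-algebra of Caratheodory measurable sets (the
   completion of the one generated by the internal sets). *)
Definition loeb_measure : set X -> \bar R := (loeb_content^*)%mu.

Definition loeb_measurable : set (set X) := loeb_measure.-cara.-measurable.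

Lemma loeb_measure_internal Y : loeb_measure (internal U Y) = (density Y)%:E.
Proof.
rewrite -loeb_content_internal; apply: measurable_mu_extE; by exists Y.
Qed.

Lemma loeb_measureT : loeb_measure setT = 1%E.
Proof.
rewrite -(internalT U) loeb_measure_internal; congr EFin.
apply: ulim_near; near=> n.
by rewrite finset.cardsT card_ord divff// pnatr_eq0.
Unshelve. all: by end_near. Qed.

Lemma loeb_measurable_internal Y : loeb_measurable (internal U Y).
Proof.
apply: sub_caratheodory; apply: sub_sigma_algebra; by exists Y.
Qed.

End LoebMeasure.

Section LoebAction.
Variables (R : realType) (U : npUltrafilter).

(* Well defined modulo null sets only; see loeb_act_pi. *)
Definition loeb_act (a : sofic_group R U) (p : loeb_space U) : loeb_space U :=
  \pi_(loeb_space U) (fun n => repr a n (repr p n)).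

Lemma loeb_act_pi (s : perm_seq) :
  loeb_measure R [set p | loeb_act (\pi_(sofic_group R U) s) p <>
    \pi_(loeb_space U) (fun n => s n (repr p n))] = 0%E.
Proof.
set s' := repr (\pi_(sofic_group R U) s).
pose D n : {set 'I_n.+1} := finset (fun x => s' n x != s n x).
have -> : [set p | loeb_act (\pi_(sofic_group R U) s) p <>
    \pi_(loeb_space U) (fun n => s n (repr p n))] = internal U D.
  apply/seteqP; split=> p /=; rewrite /loeb_act -/s'.
    move=> sp; rewrite -[p]reprK; apply/internal_pi.
    have /ufN : ~ ufilter U [set n | s' n (repr p n) = s n (repr p n)].
      by move=> h; apply: sp; apply/loeb_piP.
    by apply: filterS => n /= /eqP; rewrite inE.
  rewrite -{1}[p]reprK => /internal_pi pD /loeb_piP spE.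
  apply: (@filter_not_empty _ (ufilter U)).
  by apply: filterS2 pD spE => n; rewrite inE => /eqP.
rewrite loeb_measure_internal; congr EFin.
rewrite -[RHS](@sofic_repr R U s); congr ulim; apply/funext => n.
by rewrite /hamming; congr (_%:R / _); apply: eq_card => x; rewrite !inE.
Qed.

Definition acts_ergodically (A : set (sofic_group R U)) : Prop :=
  forall Y : set (loeb_space U), loeb_measurable R Y ->
    (forall a, A a -> loeb_measure R ((loeb_act a @` Y) `+` Y) = 0%E) ->
    loeb_measure R Y = 0%E \/ loeb_measure R Y = 1%E.

End LoebAction.

(* Main.v *)
From HB Require Import structures.
Require Import Defs.
From mathcomp Require Import all_fingroup.
From mathcomp Require Import all_boot all_order all_algebra.
From mathcomp Require Import all_classical all_reals all_analysis.
From mathcomp.real_closed Require Import complex.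
From mathcomp Require Import ring lra zify.

(** Write [C] for the centralizer of [pi G] and [D] for the centralizer of [C],
so that [pi G] is contained in [D].  For d in [D] the set of the points fixed
by d is invariant under [C], hence of measure 0 or 1: any two elements of [D]
are at distance 0 or 1 ([zero_one]).  If [D] were the ultraproduct of sets of
permutations, then at almost all indices the distances within such a set would
be close to 0 or to 1, identifying the permutations at small distance would
turn it into a finite group, and G would embed locally into these groups.  Now
both centralizers are only infinite intersections of such internal sets; the
point is that they can be replaced by single ones, up to small errors.

For [C], this is property (T).  Sequences of permutations have graphs in a
Hilbert space of matrix sequences, the entries being weighted by 1/n, on which
the universal sofic group acts by conjugation.  If c commutes up to e with the
image of a Kazhdan set, its graph is close to a G-invariant matrix, and that
matrix can be rounded to a sequence of permutations which commutes with [pi G]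
([rounding], [kazhdan_stability]).  So the internal set A of the permutations
that commute up to e with finitely many elements of [pi G] contains [C] and
lies in a small neighbourhood of it.

For [D], let L be the internal set of the permutations that commute up to eta
with all elements of A.  It contains [D].  Conversely an element d of L commutes
up to eta with all elements of [C], so the [C]-orbit of its graph has small
diameter; the point of least norm of the closed convex hull of that orbit is a
[C]-invariant matrix close to the graph, and rounding gives an element of [D]
close to d ([center], [commutant_stability]).

Therefore, at almost all indices, distances within L are close to 0 or to 1,
and a left translate of an element of L by an element of [pi G] is close to L
again.  Translations then permute the classes of L modulo small distance, and this is
the local embedding of G ([local_embedding]).  When G is finitely presented, a
local embedding of a finite set that contains the values of all suffixes of the
relators extends to a homomorphism ([LEF_residually_finite]). *)

Set Implicit Arguments.
Unset Strict Implicit.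
Unset Printing Implicit Defensive.

Import Order.TTheory GRing.Theory Num.Theory.
Import numFieldNormedType.Exports.

Local Open Scope classical_set_scope.
Local Open Scope ring_scope.

(** * Complete semi-inner product spaces *)

(** Null vectors are kept and the form is only controlled on a subspace
[sh_dom] of the carrier.  Concrete matrix sequences can then be manipulated
without quotients, and passing to a closed subspace only changes [sh_dom]. *)
Record semiHilbert (R : realType) := SemiHilbert {
  sh_space :> lmodType R;
  sh_dom : set sh_space;
  sh_form : sh_space -> sh_space -> R;
  sh_dom0 : sh_dom 0;
  sh_dom_lin : forall a u v, sh_dom u -> sh_dom v -> sh_dom (a *: u + v);
  sh_formC : forall u v, sh_form u v = sh_form v u;
  sh_form_lin : forall a u v w, sh_dom u -> sh_dom v -> sh_dom w ->
    sh_form (a *: u + v) w = a * sh_form u w + sh_form v w;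
  sh_form_ge0 : forall u, sh_dom u -> 0 <= sh_form u u;
  sh_complete : forall u : nat -> sh_space, (forall k, sh_dom (u k)) ->
    (forall e, 0 < e -> exists N, forall m n, (N <= m)%N -> (N <= n)%N ->
       sh_form (u m - u n) (u m - u n) < e) ->
    exists2 l, sh_dom l & forall e, 0 < e -> exists N, forall n, (N <= n)%N ->
       sh_form (u n - l) (u n - l) < e
}.

Section SemiHilbertTheory.
Variables (R : realType) (S : semiHilbert R).
Implicit Types (u v w : S) (a : R).
Local Notation dom := (@sh_dom R S).
Local Notation "'[ u , v ]" := (sh_form u v).
Local Notation "'[ u ]" := (sh_form u u).

Lemma domD u v : dom u -> dom v -> dom (u + v).
Proof. by move=> du dv; rewrite -[u]scale1r; exact: sh_dom_lin. Qed.

Lemma domZ a u : dom u -> dom (a *: u).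
Proof. by move=> du; rewrite -[_ *: _]addr0; apply: sh_dom_lin => //; exact: sh_dom0. Qed.

Lemma domB u v : dom u -> dom v -> dom (u - v).
Proof. by move=> du dv; rewrite -scaleN1r addrC; exact: sh_dom_lin. Qed.

Lemma formDl u v w : dom u -> dom v -> dom w -> '[u + v, w] = '[u, w] + '[v, w].
Proof. by move=> *; rewrite -{1}[u]scale1r sh_form_lin// mul1r. Qed.

Lemma formDr u v w : dom u -> dom v -> dom w -> '[w, u + v] = '[w, u] + '[w, v].
Proof. by move=> *; rewrite sh_formC formDl// !(sh_formC w). Qed.

Lemma form0l w : dom w -> '[0, w] = 0.
Proof.
move=> dw; have := formDl (sh_dom0 _) (sh_dom0 _) dw; rewrite addr0 => /eqP.
by rewrite -subr_eq0 opprD addNKr oppr_eq0 => /eqP.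
Qed.

Lemma formZl a u w : dom u -> dom w -> '[a *: u, w] = a * '[u, w].
Proof.
move=> du dw; rewrite -[_ *: _]addr0 sh_form_lin ?form0l ?addr0//.
exact: sh_dom0.
Qed.

Lemma formZr a u w : dom u -> dom w -> '[w, a *: u] = a * '[w, u].
Proof. by move=> *; rewrite sh_formC formZl// sh_formC. Qed.

Lemma formNl u w : dom u -> dom w -> '[- u, w] = - '[u, w].
Proof. by move=> *; rewrite -scaleN1r formZl// mulN1r. Qed.

Lemma domN u : dom u -> dom (- u).
Proof. by rewrite -scaleN1r; exact: domZ. Qed.

Lemma formBl u v w : dom u -> dom v -> dom w -> '[u - v, w] = '[u, w] - '[v, w].
Proof. by move=> du dv dw; rewrite formDl ?formNl//; exact: domN. Qed.

Lemma formBr u v w : dom u -> dom v -> dom w -> '[w, u - v] = '[w, u] - '[w, v].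
Proof. by move=> *; rewrite sh_formC formBl// !(sh_formC w). Qed.

Lemma formB2 u v : dom u -> dom v -> '[u - v] = '[u] - 2 * '[u, v] + '[v].
Proof.
move=> du dv; have db := domB du dv.
by rewrite formBl// !formBr// (sh_formC v u); ring.
Qed.

Lemma formBC u v : dom u -> dom v -> '[u - v] = '[v - u].
Proof. by move=> du dv; rewrite !formB2// (sh_formC v u); ring. Qed.

Lemma formD2 u v : dom u -> dom v -> '[u + v] = '[u] + 2 * '[u, v] + '[v].
Proof.
move=> du dv; have db := domD du dv.
by rewrite formDl// !formDr// (sh_formC v u); ring.
Qed.

Lemma formZ2 a u : dom u -> '[a *: u] = a ^+ 2 * '[u].
Proof. by move=> du; rewrite formZl ?formZr//; [ring | exact: domZ]. Qed.

Lemma formD_le u v : dom u -> dom v -> '[u + v] <= 2 * '[u] + 2 * '[v].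
Proof.
move=> du dv; have := sh_form_ge0 (domB du dv).
by rewrite formB2// formD2//; lra.
Qed.

Lemma formB_le v u w : dom u -> dom v -> dom w ->
  '[u - w] <= 2 * '[u - v] + 2 * '[v - w].
Proof.
move=> du dv dw; have -> : u - w = (u - v) + (v - w) by rewrite addrA subrK.
by apply: formD_le; exact: domB.
Qed.

Lemma null_trans v u w : dom u -> dom v -> dom w ->
  '[u - v] = 0 -> '[v - w] = 0 -> '[u - w] = 0.
Proof.
move=> du dv dw uv vw; apply/eqP; rewrite eq_le sh_form_ge0 ?andbT; last exact: domB.
by have := formB_le du dv dw; rewrite uv vw; lra.
Qed.

Lemma cauchy_schwarz u v : dom u -> dom v -> '[u, v] ^+ 2 <= '[u] * '[v].
Proof.
move=> du dv; have := sh_form_ge0 dv; rewrite le_eqVlt => /orP[/eqP v0|v_gt0].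
  have H t : 0 <= '[u] + 2 * t * '[u, v].
    have := sh_form_ge0 (domD du (domZ t dv)).
    rewrite formD2//; last exact: domZ.
    by rewrite formZr// formZ2// -v0 mulr0 addr0 mulrA.
  rewrite -v0 mulr0; have [->|/eqP nz] := eqVneq '[u, v] 0; first by rewrite expr0n.
  have := H (- ('[u] + 1) / (2 * '[u, v])).
  have -> : 2 * (- ('[u] + 1) / (2 * '[u, v])) * '[u, v] = - ('[u] + 1).
    by field; apply/eqP.
  lra.
have := sh_form_ge0 (domB (domZ '[v] du) (domZ '[u, v] dv)).
rewrite formB2 ?formZ2 ?formZl ?formZr//; try exact: domZ.
rewrite (_ : _ - _ + _ = '[v] * ('[u] * '[v] - '[u, v] ^+ 2)); last ring.
by rewrite pmulr_rge0// subr_ge0.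
Qed.

Lemma null_formr u v : dom u -> dom v -> '[u] = 0 -> '[u, v] = 0.
Proof.
move=> du dv u0; apply/eqP; rewrite -sqrf_eq0 eq_le sqr_ge0 andbT.
by have := cauchy_schwarz du dv; rewrite u0 mul0r.
Qed.

Lemma null_forml u v : dom u -> dom v -> '[v] = 0 -> '[u, v] = 0.
Proof. by move=> du dv; rewrite sh_formC; exact: null_formr. Qed.

Lemma null_form_eq u u' v v' : dom u -> dom u' -> dom v -> dom v' ->
  '[u - u'] = 0 -> '[v - v'] = 0 -> '[u, v] = '[u', v'].
Proof.
move=> du du' dv dv' /(null_formr (domB du du')) uu' vv'.
have /(null_forml (domB dv dv')) vv := vv'.
transitivity ('[u', v]); last first.
  by apply/eqP; rewrite -subr_eq0 -formBr// null_forml//; exact: domB.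
by apply/eqP; rewrite -subr_eq0 -formBl// uu'.
Qed.

(** Orthogonality to a fixed vector is a closed condition, by the Cauchy-Schwarz
inequality; this makes [complement] complete. *)
Lemma orthogonal_complete (I : set S) (u : nat -> S) l : I `<=` dom ->
  (forall k, dom (u k)) -> dom l ->
  (forall k w, I w -> '[u k, w] = 0) ->
  (forall e, 0 < e -> exists N, forall n, (N <= n)%N -> '[u n - l] < e) ->
  forall w, I w -> '[l, w] = 0.
Proof.
move=> Id du dl uI ul w Iw; have dw := Id _ Iw.
apply/eqP; apply: contraT => nz.
have b0 : 0 < '[l, w] ^+ 2 by rewrite lt_def sqrf_eq0 nz sqr_ge0.
have w0 := sh_form_ge0 dw.
have [|N /(_ N (leqnn N))] := ul ('[l, w] ^+ 2 / ('[w] + 1)).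
  by rewrite divr_gt0// ltr_wpDl.
rewrite ltr_pdivlMr ?ltr_wpDl// => lt1.
have := cauchy_schwarz (domB (du N) dl) dw.
rewrite formBl// uI// sub0r sqrrN.
have := sh_form_ge0 (domB (du N) dl).
nra.
Qed.

End SemiHilbertTheory.

Section Complement.
Variables (R : realType) (S : semiHilbert R) (I : set S).
Hypothesis Id : I `<=` @sh_dom R S.

Definition complement_dom : set S :=
  [set u | sh_dom u /\ forall w, I w -> sh_form u w = 0].

Fact complement_dom0 : complement_dom 0.
Proof. by split=> [|w /Id]; [exact: sh_dom0 | exact: form0l]. Qed.

Fact complement_dom_lin a u v :
  complement_dom u -> complement_dom v -> complement_dom (a *: u + v).
Proof.
move=> [du uI] [dv vI]; split=> [|w Iw]; first exact: sh_dom_lin.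
by rewrite sh_form_lin ?uI ?vI ?mulr0 ?addr0//; exact: Id.
Qed.

Definition complement : semiHilbert R.
Proof.
refine (@SemiHilbert R S complement_dom (@sh_form R S)
  complement_dom0 complement_dom_lin (@sh_formC R S) _ _ _).
- by move=> a u v w [? _] [? _] [? _]; exact: sh_form_lin.
- by move=> u [? _]; exact: sh_form_ge0.
- move=> u du Cu; have du' k : sh_dom (u k) := (du k).1.
  have [l dl ul] := sh_complete du' Cu; exists l => //; split=> // w Iw.
  by apply: (@orthogonal_complete R S I u) => // k w' Iw'; case: (du k) => _; apply.
Defined.

End Complement.

(** * The quotient by null vectors *)

Section Quotient.
Variables (R : realType) (S : semiHilbert R).
Implicit Types (u v w : S).
Local Notation dom := (@sh_dom R S).
Local Notation "'[ u , v ]" := (sh_form u v).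
Local Notation "'[ u ]" := (sh_form u u).

(** A canonical vector in the class of u modulo null vectors: it depends on the
class only, so its values parametrize the quotient. *)
Definition null_rep u : S := xget 0 [set w | dom w /\ '[w - u] = 0].

Lemma null_repP u : dom u -> dom (null_rep u) /\ '[null_rep u - u] = 0.
Proof.
move=> du; rewrite /null_rep; case: xgetP => // /(_ u) /=; case; split=> //.
by rewrite subrr form0l//; exact: sh_dom0.
Qed.

Lemma null_rep_eq u v : dom u -> dom v -> '[u - v] = 0 -> null_rep u = null_rep v.
Proof.
move=> du dv uv; rewrite /null_rep; congr xget; apply/seteqP; split=> w /= [dw wu].
  by split=> //; exact: (null_trans dw du dv).
by split=> //; apply: (null_trans dw dv du) => //; rewrite formBC.
Qed.

Definition sh_quot := {u : S | `[< dom u /\ null_rep u = u >]}.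
HB.instance Definition _ := Choice.on sh_quot.
Implicit Types x y z : sh_quot.

Fact null_rep_norm u : dom u -> `[< dom (null_rep u) /\ null_rep (null_rep u) = null_rep u >].
Proof. by move=> /[dup] du /null_repP[dru ru]; apply/asboolP; split=> //; exact: null_rep_eq. Qed.

Definition sh_class u : sh_quot :=
  insubd (Sub (null_rep 0) (null_rep_norm (sh_dom0 S)) : sh_quot) (null_rep u).

Lemma val_dom x : dom (val x).
Proof. by case: x => u /= /asboolP[]. Qed.

Lemma val_class u : dom u -> val (sh_class u) = null_rep u.
Proof. by move=> /null_rep_norm du; rewrite insubdK. Qed.

Lemma valK_class x : sh_class (val x) = x.
Proof. by apply: val_inj; rewrite val_class; case: x => u /= /asboolP[]. Qed.

Lemma class_eq u v : dom u -> dom v -> sh_class u = sh_class v <-> '[u - v] = 0.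
Proof.
move=> du dv; split=> [/(congr1 val)|uv]; last first.
  by apply: val_inj; rewrite !val_class//; exact: null_rep_eq.
rewrite !val_class// => uv; have [dru ru] := null_repP du; have [drv rv] := null_repP dv.
by apply: (null_trans du dru dv); [rewrite formBC | rewrite uv].
Qed.

Lemma class_val u : dom u -> '[val (sh_class u) - u] = 0.
Proof. by move=> /[dup] du /null_repP[_]; rewrite val_class. Qed.

Definition quot_add x y := sh_class (val x + val y).
Definition quot_scale (a : R) x := sh_class (a *: val x).
Definition quot_opp x := sh_class (- val x).
Definition quot_form x y : R := '[val x, val y].

Lemma quot_addE u v : dom u -> dom v ->
  quot_add (sh_class u) (sh_class v) = sh_class (u + v).
Proof.
move=> du dv; have cu := val_dom (sh_class u); have cv := val_dom (sh_class v).
apply/class_eq; try exact: domD.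
apply/eqP; rewrite eq_le sh_form_ge0 ?andbT; last by apply: domB; exact: domD.
rewrite opprD addrACA; apply: (le_trans (formD_le (domB cu du) (domB cv dv))).
by rewrite !class_val// !mulr0 addr0.
Qed.

Lemma quot_scaleE a u : dom u -> quot_scale a (sh_class u) = sh_class (a *: u).
Proof.
move=> du; have cu := val_dom (sh_class u); apply/class_eq; try exact: domZ.
by rewrite -scalerBr formZ2; [rewrite class_val// mulr0 | exact: domB].
Qed.

Lemma quot_formE u v : dom u -> dom v ->
  quot_form (sh_class u) (sh_class v) = '[u, v].
Proof.
by move=> du dv; apply: null_form_eq; rewrite ?class_val//; exact: val_dom.
Qed.

Lemma quotP (P : sh_quot -> Prop) : (forall u, dom u -> P (sh_class u)) -> forall x, P x.
Proof. by move=> Pc x; rewrite -[x]valK_class; apply: Pc; exact: val_dom. Qed.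

Fact quot_addA : associative quot_add.
Proof.
elim/quotP=> u du; elim/quotP=> v dv; elim/quotP=> w dw.
by rewrite !quot_addE ?addrA//; exact: domD.
Qed.

Fact quot_addC : commutative quot_add.
Proof. by move=> x y; rewrite /quot_add addrC. Qed.

Fact quot_add0 : left_id (sh_class 0) quot_add.
Proof. by elim/quotP=> u du; rewrite quot_addE ?add0r//; exact: sh_dom0. Qed.

Fact quot_addN : left_inverse (sh_class 0) quot_opp quot_add.
Proof.
move=> x; rewrite -[x in quot_add _ x]valK_class quot_addE ?addNr//.
  by apply: domN; exact: val_dom.
exact: val_dom.
Qed.

HB.instance Definition _ :=
  GRing.isZmodule.Build sh_quot quot_addA quot_addC quot_add0 quot_addN.

Fact quot_scaleA a b x : quot_scale a (quot_scale b x) = quot_scale (a * b) x.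
Proof. by elim/quotP: x => u du; rewrite !quot_scaleE ?scalerA//; exact: domZ. Qed.

Fact quot_scale1 : left_id 1 quot_scale.
Proof. by elim/quotP=> u du; rewrite quot_scaleE ?scale1r. Qed.

Fact quot_scaleDr : right_distributive quot_scale +%R.
Proof.
move=> a; elim/quotP=> u du; elim/quotP=> v dv; rewrite /GRing.add/=.
by rewrite quot_addE// !quot_scaleE ?quot_addE ?scalerDr//; [exact: domZ..|exact: domD].
Qed.

Fact quot_scaleDl x : {morph quot_scale^~ x : a b / a + b}.
Proof.
move=> a b; elim/quotP: x => u du /=; rewrite [RHS]/GRing.add/=.
by rewrite !quot_scaleE// quot_addE ?scalerDl//; exact: domZ.
Qed.

HB.instance Definition _ := GRing.Zmodule_isLmodule.Build R sh_quot
  quot_scaleA quot_scale1 quot_scaleDr quot_scaleDl.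

Lemma classD u v : dom u -> dom v -> sh_class (u + v) = sh_class u + sh_class v.
Proof. by move=> du dv; rewrite -quot_addE. Qed.

Lemma classZ a u : dom u -> sh_class (a *: u) = a *: sh_class u.
Proof. by move=> du; rewrite -quot_scaleE. Qed.

Lemma classB u v : dom u -> dom v -> sh_class (u - v) = sh_class u - sh_class v.
Proof. by move=> du dv; rewrite classD; [rewrite -[- v]scaleN1r classZ// scaleN1r | | exact: domN]. Qed.

Lemma quot_formC x y : quot_form x y = quot_form y x.
Proof. exact: sh_formC. Qed.

Lemma quot_form_lin a x y z :
  quot_form (a *: x + y) z = a * quot_form x z + quot_form y z.
Proof.
elim/quotP: x => u du; elim/quotP: y => v dv; elim/quotP: z => w dw.
by rewrite -classZ// -classD ?quot_formE ?sh_form_lin//; [exact: sh_dom_lin|exact: domZ].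
Qed.

Lemma quot_form_ge0 x : 0 <= quot_form x x.
Proof. by apply: sh_form_ge0; exact: val_dom. Qed.

Lemma quot_form_eq0 x : quot_form x x = 0 -> x = 0.
Proof.
elim/quotP: x => u du; rewrite quot_formE// => u0; apply/class_eq => //.
  exact: sh_dom0.
by rewrite subr0.
Qed.

Lemma quot_complete (x : nat -> sh_quot) :
  (forall e, 0 < e -> exists N, forall m n, (N <= m)%N -> (N <= n)%N ->
     quot_form (x m - x n) (x m - x n) < e) ->
  exists l, forall e, 0 < e -> exists N, forall n, (N <= n)%N ->
     quot_form (x n - l) (x n - l) < e.
Proof.
have E y u : dom u -> quot_form (y - sh_class u) (y - sh_class u) = '[val y - u].
  move=> du; rewrite -[y in LHS]valK_class -classB ?quot_formE//; try exact: domB (val_dom _) _.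
  exact: val_dom.
move=> Cx; have [|e e0|l dl xl] := @sh_complete R S (val \o x).
- by move=> k; exact: val_dom.
- have [N NP] := Cx e e0; exists N => m n Nm Nn /=.
  by rewrite -E ?valK_class; [exact: NP|exact: val_dom].
exists (sh_class l) => e e0; have [N NP] := xl e e0.
by exists N => n Nn; rewrite E//; exact: NP.
Qed.

End Quotient.

(** * Property (T) for almost representations *)

Section ComplexScaling.
Variables (R : realType) (X : lmodType R).

(** The complexification X + iX of a real vector space X. *)
Definition cplx := (X * X)%type.
HB.instance Definition _ := GRing.Zmodule.on cplx.
Implicit Types (x y : cplx) (z : R[i]).

Definition cplx_scale z x : cplx :=
  (complex.Re z *: x.1 - complex.Im z *: x.2,
   complex.Re z *: x.2 + complex.Im z *: x.1).

Fact cplx_scaleA z z' x : cplx_scale z (cplx_scale z' x) = cplx_scale (z * z') x.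
Proof.
case: z => a b; case: z' => c d; case: x => u v; rewrite /cplx_scale /=.
congr pair; rewrite scalerBr scalerDr !scalerA scalerBl scalerDl.
  by rewrite !opprD -!addrA; congr (_ + _); rewrite [LHS]addrA [LHS]addrC.
by rewrite -!addrA; congr (_ + _); rewrite [LHS]addrA [LHS]addrC.
Qed.

Fact cplx_scale1 : left_id 1 cplx_scale.
Proof. by case=> u v; rewrite /cplx_scale /= !scale1r !scale0r subr0 addr0. Qed.

Fact cplx_scaleDr : right_distributive cplx_scale +%R.
Proof.
move=> [a b] [u v] [u' v']; rewrite /cplx_scale /=.
by congr pair => /=; rewrite !scalerDr ?opprD addrACA.
Qed.

Fact cplx_scaleDl x : {morph cplx_scale^~ x : z z' / z + z'}.
Proof.
case: x => u v [a b] [c d]; rewrite /cplx_scale /=.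
by congr pair => /=; rewrite !scalerDl ?opprD addrACA.
Qed.

HB.instance Definition _ := GRing.Zmodule_isLmodule.Build R[i] cplx
  cplx_scaleA cplx_scale1 cplx_scaleDr cplx_scaleDl.

End ComplexScaling.

Section Complexification.
Variables (R : realType) (S : semiHilbert R).
Local Notation X := (sh_quot S).
Local Notation q := (@quot_form R S).
Local Notation cplx := (cplx X).
Implicit Types (x y : cplx) (z : R[i]).

(** The sesquilinear extension of the real form to u + iv. *)
Definition cplx_form x y : R[i] :=
  Complex (q x.1 y.1 + q x.2 y.2) (q x.2 y.1 - q x.1 y.2).

Lemma quot_formDl (u v w : X) : q (u + v) w = q u w + q v w.
Proof. by rewrite -{1}[u]scale1r quot_form_lin mul1r. Qed.

Lemma quot_form0l (w : X) : q 0 w = 0.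
Proof. by have := quot_formDl 0 0 w; rewrite addr0; lra. Qed.

Lemma quot_formZl a (u w : X) : q (a *: u) w = a * q u w.
Proof. by rewrite -[_ *: _]addr0 quot_form_lin quot_form0l addr0. Qed.

Lemma quot_formNl (u w : X) : q (- u) w = - q u w.
Proof. by rewrite -scaleN1r quot_formZl mulN1r. Qed.

Fact cplx_form_herm x y : cplx_form x y = (-1) ^+ false * Num.Def.conjC (cplx_form y x).
Proof.
rewrite expr0 mul1r /cplx_form; case: x => u v; case: y => u' v' /=.
rewrite (quot_formC u') (quot_formC v' v) (quot_formC v') (quot_formC u' v).
by apply/eqP; rewrite eq_complex /= eqxx opprB eqxx.
Qed.

Fact cplx_form_linl z x y w : cplx_form (z *: x + y) w = z * cplx_form x w + cplx_form y w.
Proof.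
case: z x y w => a b [u v] [u' v'] [u'' v'']; rewrite /cplx_form /=.
have lin1 t : q (a *: u - b *: v + u') t = a * q u t - b * q v t + q u' t.
  by rewrite quot_formDl quot_formDl quot_formNl !quot_formZl.
have lin2 t : q (a *: v + b *: u + v') t = a * q v t + b * q u t + q v' t.
  by rewrite quot_formDl quot_formDl !quot_formZl.
change (Complex
  (q (a *: u - b *: v + u') u'' + q (a *: v + b *: u + v') v'')
  (q (a *: v + b *: u + v') u'' - q (a *: u - b *: v + u') v'') =
  Complex a b * Complex (q u u'' + q v v'') (q v u'' - q u v'') +
  Complex (q u' u'' + q v' v'') (q v' u'' - q u' v'')).
rewrite !lin1 !lin2; apply/eqP; rewrite eq_complex /=.
move: (q u u'') (q v v'') (q u' u'') (q v' v'') (q v u'') (q u v'') (q v' u'') (q u' v'').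
by move=> *; apply/andP; split; apply/eqP; ring.
Qed.

Fact cplx_form_linr z x y w :
  cplx_form w (z *: x + y) = Num.Def.conjC z * cplx_form w x + cplx_form w y.
Proof.
rewrite cplx_form_herm cplx_form_linl expr0 mul1r rmorphD rmorphM /=.
by congr (_ * _ + _); rewrite [RHS]cplx_form_herm mul1r.
Qed.

HB.instance Definition _ := @bilinear_isBilinear.Build R[i] cplx cplx R[i]
  *%R (Num.Def.conjC \; *%R) cplx_form
  (conj (fun w z x y => cplx_form_linl z x y w) (fun w z x y => cplx_form_linr z x y w)).
HB.instance Definition _ :=
  @isHermitianSesquilinear.Build R[i] cplx false Num.Def.conjC cplx_form cplx_form_herm.

Fact cplx_form_gt0 x : x != 0 -> 0 < cplx_form x x.
Proof.
case: x => u v nz; rewrite /cplx_form /= (quot_formC v) subrr ltcE /= eqxx /=.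
have := quot_form_ge0 u; have := quot_form_ge0 v.
rewrite !le_eqVlt => /orP[/eqP v0|v0] /orP[/eqP u0|u0]; try lra.
by case/eqP: nz; rewrite (quot_form_eq0 (esym u0)) (quot_form_eq0 (esym v0)).
Qed.

HB.instance Definition _ := isDotProduct.Build R[i] cplx cplx_form cplx_form_gt0.

Lemma cplx_normE x : inner_norm (cplx_form : {dot cplx for Num.Def.conjC}) x =
  Num.sqrt (q x.1 x.1 + q x.2 x.2).
Proof. by []. Qed.

Fact cplx_complete (u : nat -> cplx) :
  (forall e : R, 0 < e -> \forall m & n \near \oo,
     inner_norm (cplx_form : {dot cplx for Num.Def.conjC}) (u m - u n) < e) ->
  exists l : cplx,
    inner_norm (cplx_form : {dot cplx for Num.Def.conjC}) (u n - l) @[n --> \oo] --> (0 : R).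
Proof.
move=> Cu.
have Cq e : 0 < e -> exists N, forall m n, (N <= m)%N -> (N <= n)%N ->
    q (u m - u n).1 (u m - u n).1 < e /\ q (u m - u n).2 (u m - u n).2 < e.
  move=> e0; have [|[A B] /= [[N _ NA] [N' _ NB]] AB] := Cu (Num.sqrt e).
    by rewrite sqrtr_gt0.
  exists (maxn N N') => m n; rewrite !geq_max => /andP[Nm _] /andP[_ Nn].
  have /= := AB (m, n) (conj (NA _ Nm) (NB _ Nn)).
  rewrite cplx_normE ltr_sqrt// => ume.
  by split; apply: le_lt_trans ume; rewrite (lerDl, lerDr) quot_form_ge0.
have [|l1 ul1] := @quot_complete R S (fun n => (u n).1).
  by move=> e /Cq[N NP]; exists N => m n Nm Nn; case: (NP m n Nm Nn).
have [|l2 ul2] := @quot_complete R S (fun n => (u n).2).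
  by move=> e /Cq[N NP]; exists N => m n Nm Nn; case: (NP m n Nm Nn).
exists (l1, l2); apply/cvgr0Pnorm_lt => e e0.
have e2 : 0 < e ^+ 2 / 2 by rewrite divr_gt0// exprn_gt0.
have [N NP] := ul1 _ e2; have [N' NP'] := ul2 _ e2.
exists (maxn N N') => // n /=; rewrite geq_max => /andP[Nn N'n].
rewrite cplx_normE ger0_norm ?sqrtr_ge0//.
rewrite -[X in _ < X](ger0_norm (ltW e0)) -sqrtr_sqr ltr_sqrt ?exprn_gt0//.
by have /= := NP _ Nn; have /= := NP' _ N'n; lra.
Qed.

Definition cplx_hilbert : hilbertType R :=
  @HilbertType R cplx (cplx_form : {dot cplx for Num.Def.conjC}) cplx_complete.

End Complexification.

(** A family of isometries of a semi-inner product space that is multiplicative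
up to null vectors only; it induces a unitary representation on the
complexified quotient, to which property (T) applies. *)
Section InvariantVector.
Variables (R : realType) (G : groupType) (S : semiHilbert R).
Variable rho : G -> S -> S.
Implicit Types (g h : G) (u v : S).
Hypothesis rho_dom : forall g u, sh_dom u -> sh_dom (rho g u).
Hypothesis rho_lin : forall g a u v, sh_dom u -> sh_dom v ->
  rho g (a *: u + v) = a *: rho g u + rho g v.
Hypothesis rho_form : forall g u v, sh_dom u -> sh_dom v ->
  sh_form (rho g u) (rho g v) = sh_form u v.
Hypothesis rho1 : forall u, sh_dom u -> sh_form (rho 1%g u - u) (rho 1%g u - u) = 0.
Hypothesis rhoM : forall g h u, sh_dom u ->
  sh_form (rho (g * h)%g u - rho g (rho h u)) (rho (g * h)%g u - rho g (rho h u)) = 0.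

Definition quot_rho g (x : sh_quot S) : sh_quot S := sh_class (rho g (val x)).

Lemma rhoB g u v : sh_dom u -> sh_dom v -> rho g (u - v) = rho g u - rho g v.
Proof. by move=> du dv; rewrite addrC -scaleN1r rho_lin// scaleN1r addrC. Qed.

Lemma quot_rhoE g u : sh_dom u -> quot_rho g (sh_class u) = sh_class (rho g u).
Proof.
move=> du; have dv := val_dom (sh_class u).
apply/class_eq; try exact: rho_dom.
by rewrite -rhoB// rho_form ?class_val//; exact: domB.
Qed.

Definition cplx_rho g (x : cplx_hilbert S) : cplx_hilbert S :=
  (quot_rho g x.1, quot_rho g x.2).

Lemma quot_rho_lin g a (x y : sh_quot S) :
  quot_rho g (a *: x + y) = a *: quot_rho g x + quot_rho g y.
Proof.
elim/quotP: x => u du; elim/quotP: y => v dv.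
rewrite -classZ// -classD//; last exact: domZ.
rewrite !quot_rhoE//; last exact: sh_dom_lin.
by rewrite rho_lin// classD ?classZ//; [exact: rho_dom|exact/domZ/rho_dom|exact: rho_dom].
Qed.

Lemma quot_rho_form g (x y : sh_quot S) :
  quot_form (quot_rho g x) (quot_rho g y) = quot_form x y.
Proof.
elim/quotP: x => u du; elim/quotP: y => v dv.
by rewrite !quot_rhoE// !quot_formE ?rho_form//; exact: rho_dom.
Qed.

Fact cplx_rho_linear g : linear (cplx_rho g).
Proof.
move=> [a b] [x y] [x' y']; have rN z : quot_rho g (- z) = - quot_rho g z.
  have r0 : quot_rho g 0 = 0.
    by have /eqP := quot_rho_lin g (-1) 0 0; rewrite scaler0 addr0 scaleN1r addNr => /eqP.
  by rewrite -[- z]addr0 -scaleN1r quot_rho_lin r0 addr0 scaleN1r.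
have rD z z' : quot_rho g (z + z') = quot_rho g z + quot_rho g z'.
  by rewrite -{1}[z]scale1r quot_rho_lin scale1r.
have rZ c z : quot_rho g (c *: z) = c *: quot_rho g z.
  by apply: (addIr (quot_rho g z)); rewrite -quot_rho_lin rD.
apply: injective_projections.
  change (quot_rho g ((a *: x - b *: y) + x') =
    (a *: quot_rho g x - b *: quot_rho g y) + quot_rho g x').
  by rewrite !rD rN !rZ.
change (quot_rho g ((a *: y + b *: x) + y') =
  (a *: quot_rho g y + b *: quot_rho g x) + quot_rho g y').
by rewrite !rD !rZ.
Qed.

HB.instance Definition _ g :=
  GRing.isLinear.Build R[i] (cplx_hilbert S) (cplx_hilbert S) *:%R (cplx_rho g)
    (@cplx_rho_linear g).

Definition cplx_rho_map g : {linear cplx_hilbert S -> cplx_hilbert S} := cplx_rho g.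

Definition cplx_rep : unitary_rep G (cplx_hilbert S).
Proof.
refine (@UnitaryRep R G (cplx_hilbert S) cplx_rho_map _ _ _).
- case; elim/quotP=> u du; elim/quotP=> v dv; rewrite /= /cplx_rho /= !quot_rhoE//.
  by congr pair; apply/class_eq; rewrite ?rho1//; exact: rho_dom.
- move=> g h; case; elim/quotP=> u du; elim/quotP=> v dv; rewrite /= /cplx_rho /=.
  rewrite !quot_rhoE//; try exact: rho_dom.
  by congr pair; apply/class_eq; rewrite ?rhoM//; do ?exact: rho_dom;
    apply: (rho_dom _ _); exact: rho_dom.
- move=> g [u v] [u' v']; rewrite /= /cplx_rho /inner /= /cplx_form /=.
  by rewrite !quot_rho_form.
Defined.

Lemma hnorm_cplx (x y : sh_quot S) :
  hnorm ((x, y) : cplx_hilbert S) = Num.sqrt (quot_form x x + quot_form y y).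
Proof. by []. Qed.

Lemma cplx_rep_subE g (x y : sh_quot S) :
  cplx_rep g (x, y) - (x, y) = (quot_rho g x - x, quot_rho g y - y) :> cplx_hilbert S.
Proof. reflexivity. Qed.

Lemma property_T_invariant (Q : seq G) (eps : R) :
  (forall (V : hilbertType R) (rho : unitary_rep G V),
      (exists v : V, v != 0 /\
         forall g, g \in Q -> hnorm (rho g v - v) < eps * hnorm v) ->
      exists v : V, v != 0 /\ forall g, rho g v = v) ->
  0 < eps ->
  forall v, sh_dom v -> 0 < sh_form v v ->
  (forall g, g \in Q ->
    sh_form (rho g v - v) (rho g v - v) < eps ^+ 2 * sh_form v v) ->
  exists u, [/\ sh_dom u, 0 < sh_form u u &
    forall g, sh_form (rho g u - u) (rho g u - u) = 0].
Proof.
move=> TQ eps0 v dv v0 Qv.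
have [|[x y] [xy0 rxy]] := TQ _ cplx_rep.
  exists (sh_class v, 0); split.
    apply/eqP => -[/class_eq]; rewrite subr0 => v00.
    by move: v0; rewrite v00 ?ltxx//; exact: sh_dom0.
  move=> g /Qv gv; rewrite cplx_rep_subE !hnorm_cplx.
  rewrite quot_rhoE//.
  have -> : quot_rho g 0 = 0.
    rewrite quot_rhoE; last exact: sh_dom0.
    apply/class_eq; [by apply: rho_dom; exact: sh_dom0|exact: sh_dom0|].
    rewrite subr0; have := rhoB g (sh_dom0 S) (sh_dom0 S).
    by rewrite !subrr => ->; rewrite form0l//; exact: sh_dom0.
  rewrite subr0 !quot_form0l !addr0 -classB//; last exact: rho_dom.
  have drv : sh_dom (rho g v - v) by apply: domB => //; exact: rho_dom.
  rewrite !quot_formE//.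
  rewrite -[X in X * _](ger0_norm (ltW eps0)) -sqrtr_sqr -sqrtrM ?sqr_ge0//.
  by rewrite ltr_sqrt// mulr_gt0// exprn_gt0.
(* The invariant vector x + iy has invariant components, one of them nonzero. *)
have H z : z != 0 -> (forall g, quot_rho g z = z) ->
    exists u, [/\ sh_dom u, 0 < sh_form u u &
    forall g, sh_form (rho g u - u) (rho g u - u) = 0].
  elim/quotP: z => u du u0 ru; exists u; split=> //.
    rewrite lt_def sh_form_ge0// andbT; apply: contraNN u0 => /eqP u0.
    by apply/eqP/quot_form_eq0; rewrite quot_formE.
  by move=> k; apply/class_eq; [exact: rho_dom|by []|]; rewrite -quot_rhoE.
have [x0|xn0] := eqVneq x 0; last by apply: (H x) => // g; case: (rxy g).
apply: (H y) => [|g]; last by case: (rxy g).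
by apply: contraNN xy0 => /eqP ->; rewrite x0.
Qed.

End InvariantVector.

(** * Invariant points of bounded orbits *)

Section Center.
Variables (R : realType) (S : semiHilbert R) (Phi : set (S -> S)).
Implicit Types (u v w : S) (f : S -> S).
Local Notation dom := (@sh_dom R S).
Local Notation "'[ u , v ]" := (sh_form u v).
Local Notation "'[ u ]" := (sh_form u u).
Hypothesis Phi_dom : forall f u, Phi f -> dom u -> dom (f u).
Hypothesis Phi_lin : forall f a u v, Phi f -> dom u -> dom v ->
  f (a *: u + v) = a *: f u + f v.
Hypothesis Phi_form : forall f u v, Phi f -> dom u -> dom v -> '[f u, f v] = '[u, v].
Hypothesis Phi_comp : forall f g, Phi f -> Phi g -> Phi (f \o g).
Hypothesis Phi_id : Phi idfun.

(** Closing the orbit under midpoints only gives a dense part of its convex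
hull, which suffices to run the parallelogram argument of [center]. *)
Inductive hull v : S -> Prop :=
  | hull_orbit f : Phi f -> hull v (f v)
  | hull_mid u w : hull v u -> hull v w -> hull v (2^-1 *: u + 2^-1 *: w).

Lemma hull_dom v u : dom v -> hull v u -> dom u.
Proof.
by move=> dv; elim=> [f /Phi_dom|u' w _ du _ dw]; [apply | apply: domD; exact: domZ].
Qed.

Lemma PhiZ f a u : Phi f -> dom u -> f (a *: u) = a *: f u.
Proof.
move=> Pf du; have f0 : f 0 = 0.
  have := Phi_lin (-1) Pf (sh_dom0 _) (sh_dom0 _).
  by rewrite !scaleN1r oppr0 addr0 addNr.
by rewrite -[in LHS](addr0 (a *: u)) (Phi_lin _ Pf du (sh_dom0 _)) f0 addr0.
Qed.

Lemma PhiB f u v : Phi f -> dom u -> dom v -> f (u - v) = f u - f v.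
Proof. by move=> Pf du dv; rewrite addrC -scaleN1r Phi_lin// scaleN1r addrC. Qed.

Lemma hull_stable f v u : dom v -> Phi f -> hull v u -> hull v (f u).
Proof.
move=> dv Pf; elim=> [g Pg|u' w hu IHu hw IHw].
  exact: (hull_orbit v (Phi_comp Pf Pg)).
have du := hull_dom dv hu; have dw := hull_dom dv hw.
have -> : f (2^-1 *: u' + 2^-1 *: w) = 2^-1 *: f u' + 2^-1 *: f w.
  by rewrite (Phi_lin _ Pf du (domZ _ dw)) (PhiZ _ Pf dw).
exact: hull_mid.
Qed.

Lemma hull_form v u w : dom v -> dom w -> (forall f, Phi f -> '[f w - w] = 0) ->
  hull v u -> '[u, w] = '[v, w].
Proof.
move=> dv dw fw; elim=> [f Pf|a b ha IHa hb IHb].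
  rewrite -(Phi_form Pf dv dw); apply: null_form_eq => //; try exact: Phi_dom.
    by rewrite subrr form0l//; exact: sh_dom0.
  by rewrite formBC ?fw//; exact: Phi_dom.
have da := hull_dom dv ha; have db := hull_dom dv hb.
by rewrite formDl ?formZl ?IHa ?IHb//; try exact: domZ; lra.
Qed.

Lemma hull_dist v u r : dom v -> (forall f, Phi f -> '[v - f v] <= r) ->
  hull v u -> '[v - u] <= r.
Proof.
move=> dv fr; elim=> [f Pf|a b ha IHa hb IHb]; first exact: fr.
have da := hull_dom dv ha; have db := hull_dom dv hb.
have -> : v - (2^-1 *: a + 2^-1 *: b) = 2^-1 *: ((v - a) + (v - b)).
  rewrite !scalerDr !scalerN addrACA -scalerDl (_ : 2^-1 + 2^-1 = 1 :> R); last by lra.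
  by rewrite scale1r opprD.
rewrite formZ2; last by apply: domD; exact: domB.
have := formD_le (domB dv da) (domB dv db); lra.
Qed.

(** By the parallelogram identity a sequence in [hull v] whose norms tend to the
infimum is Cauchy, and any two such sequences have the same limit up to null
vectors; as the hull is stable under [Phi], the limit m is invariant.  Each
invariant vector has the same product with all points of the hull, so m is
also the orthogonal projection of v to the invariant vectors. *)
Lemma center v : dom v -> exists m, [/\ dom m,
  forall f, Phi f -> '[f m - m] = 0,
  forall w, dom w -> (forall f, Phi f -> '[f w - w] = 0) -> '[v - m, w] = 0 &
  forall r, (forall f, Phi f -> '[v - f v] <= r) -> '[v - m] <= 2 * r].
Proof.
move=> dv; pose E := [set '[u] | u in hull v]; pose d := inf E.
have hE : has_inf E.
  split; first by exists '[v], v => //; exact: (hull_orbit v Phi_id).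
  by exists 0 => _ [u hu <-]; apply: sh_form_ge0; exact: hull_dom hu.
have dle u : hull v u -> d <= '[u] by move=> hu; apply: inf_lbound => //; [exact: hE.2|exists u].
have close a b e : hull v a -> hull v b -> '[a] < d + e -> '[b] < d + e ->
    '[a - b] < 4 * e.
  move=> ha hb ae be; have da := hull_dom dv ha; have db := hull_dom dv hb.
  have := dle _ (hull_mid ha hb).
  rewrite -scalerDr formZ2; last exact: domD.
  by rewrite (formB2 da db) (formD2 da db); lra.
have /choice[u uP] k : exists u, hull v u /\ '[u] < d + k.+1%:R^-1.
  have k0 : 0 < k.+1%:R^-1 :> R by rewrite invr_gt0 ltr0n.
  by have [_ [u hu <-] ue] := inf_adherent k0 hE; exists u.
have hu k : hull v (u k) by case: (uP k).
have du k : dom (u k) := hull_dom dv (hu k).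
have ulim e : 0 < e -> exists N, forall n, (N <= n)%N -> '[u n] < d + e.
  move=> e0; exists (Num.truncn e^-1) => n Nn; apply: lt_trans (uP n).2 _.
  rewrite ltrD2l -[ltRHS]invrK ltf_pV2 ?posrE ?invr_gt0 ?ltr0n//.
  apply: lt_le_trans (truncnS_gt _) _.
  by rewrite ler_nat ltnS.
have [|m dm um] := sh_complete du.
  move=> e e0; have [|N NP] := ulim (e / 4); first by rewrite divr_gt0.
  exists N => k l Nk Nl; have := close _ _ _ (hu k) (hu l) (NP _ Nk) (NP _ Nl).
  by rewrite mulrC divfK.
have near_m e : 0 < e -> exists k, '[u k] < d + e /\ '[u k - m] < e.
  move=> e0; have [N NP] := ulim e e0; have [M MP] := um e e0.
  by exists (maxn N M); split; [apply: NP|apply: MP]; rewrite ?leq_maxl ?leq_maxr.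
exists m; split=> //.
- move=> f Pf; have dfm := Phi_dom Pf dm.
  apply/eqP; rewrite eq_le sh_form_ge0 ?andbT; last exact: domB.
  apply/ler_addgt0Pr => e e0; rewrite add0r.
  have [|k [uk ukm]] := near_m (e / 22); first by rewrite divr_gt0.
  have dfu := Phi_dom Pf (du k).
  have h1 : '[f m - f (u k)] < e / 22.
    have dmu := domB dm (du k).
    by rewrite -(PhiB Pf dm (du k)) (Phi_form Pf dmu dmu) formBC.
  have h2 : '[f (u k) - u k] < 4 * (e / 22).
    by apply: close => //; [exact: hull_stable|rewrite (Phi_form Pf)].
  have := formB_le dfm dfu dm; have := formB_le dfu (du k) dm; lra.
- move=> w dw fw; apply/eqP; rewrite formBl// subr_eq0; apply/eqP.
  symmetry; apply/eqP; rewrite -subr_eq0 -sqrf_eq0 eq_le sqr_ge0 andbT.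
  have w0 := sh_form_ge0 dw.
  apply/ler_addgt0Pr => e e0; rewrite add0r.
  have [|k [_ ukm]] := near_m (e / ('[w] + 1)); first by rewrite divr_gt0// ltr_wpDl.
  have := cauchy_schwarz (domB (du k) dm) dw.
  rewrite formBl// (hull_form dv dw fw (hu k)) -sqrrN opprB => /le_trans; apply.
  move: ukm; rewrite ltr_pdivlMr ?ltr_wpDl// => /ltW/(le_trans _); apply.
  by rewrite ler_wpM2l ?lerDl// sh_form_ge0//; exact: domB.
move=> r fr; apply/ler_addgt0Pr => e e0.
have [|k [_ ukm]] := near_m (e / 2); first by rewrite divr_gt0.
have := formB_le dv (du k) dm; have := hull_dist dv fr (hu k); lra.
Qed.

End Center.

(** * Sequences of matrices along an ultrafilter *)

Section UlimMore.
Variables (R : realType) (U : npUltrafilter).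
Implicit Types (f g : nat -> R).

Lemma ulim_le_near f (a b e : R) : (forall n, a <= f n <= b) ->
  (\forall n \near ufilter U, f n <= e) -> ulim U f <= e.
Proof.
move=> fab fe; have cf := ulim_cvg (U:=U) fab; rewrite /ulim; apply: limr_le => //.
Qed.

Lemma near_ulim_lt f (a b e : R) : (forall n, a <= f n <= b) ->
  ulim U f < e -> \forall n \near ufilter U, f n < e.
Proof. by move=> fab fe; exact: (cvgr_lt _ (ulim_cvg (U:=U) fab)). Qed.

Lemma near_ulim_gt f (a b e : R) : (forall n, a <= f n <= b) ->
  e < ulim U f -> \forall n \near ufilter U, e < f n.
Proof. by move=> fab fe; exact: (cvgr_gt _ (ulim_cvg (U:=U) fab)). Qed.

Lemma ulimZ f (a b c : R) : (forall n, a <= f n <= b) ->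
  ulim U (fun n => c * f n) = c * ulim U f.
Proof.
by move=> fab; apply: cvg_lim => //; apply: cvgZl_tmp; exact: (ulim_cvg (U:=U) fab).
Qed.

End UlimMore.

Section MatrixSequences.
Variables (R : realType) (U : npUltrafilter).

(** Sequences of square matrices, of size n+1 at index n; indexing the entries
by one sigma type makes them an ordinary function space. *)
Definition mxseq := {n : nat & ('I_n.+1 * 'I_n.+1)%type} -> R^o.
HB.instance Definition _ := GRing.Lmodule.on mxseq.
Implicit Types (f g h : mxseq) (s t d : perm_seq).

Definition entry f n (p : 'I_n.+1 * 'I_n.+1) : R := f (existT _ n p).

(** The weight 1/(n+1), and not 1/(n+1)^2, gives norm 1 to the graph of a
permutation. *)
Definition ip n f g : R := (\sum_(p : 'I_n.+1 * 'I_n.+1) entry f p * entry g p) / n.+1%:R.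

Lemma entry_lin n a f g (p : 'I_n.+1 * 'I_n.+1) :
  entry (a *: f + g) p = a * entry f p + entry g p.
Proof. by []. Qed.

Lemma entryB n f g (p : 'I_n.+1 * 'I_n.+1) :
  entry (f - g) p = entry f p - entry g p.
Proof. by []. Qed.

Lemma ipC n f g : ip n f g = ip n g f.
Proof. by congr (_ / _); apply: eq_bigr => p _; rewrite mulrC. Qed.

Lemma ip_lin n a f g h : ip n (a *: f + g) h = a * ip n f h + ip n g h.
Proof.
rewrite /ip mulrA -mulrDl; congr (_ / _); rewrite big_distrr -big_split /=.
by apply: eq_bigr => p _; rewrite entry_lin mulrDl mulrA.
Qed.

Lemma ip_ge0 n f : 0 <= ip n f f.
Proof. by rewrite divr_ge0// sumr_ge0// => p _; rewrite -expr2 sqr_ge0. Qed.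

Lemma ipDl n f g h : ip n (f + g) h = ip n f h + ip n g h.
Proof. by rewrite -{1}[f]scale1r ip_lin mul1r. Qed.

Lemma ipZl n a f h : ip n (a *: f) h = a * ip n f h.
Proof.
have i0 : ip n 0 h = 0 by have := ipDl n 0 0 h; rewrite addr0; lra.
by rewrite -[_ *: _]addr0 ip_lin i0 addr0.
Qed.

Lemma ipBl n f g h : ip n (f - g) h = ip n f h - ip n g h.
Proof. by rewrite ipDl -scaleN1r ipZl mulN1r. Qed.

Lemma ipB2 n f g : ip n (f - g) (f - g) = ip n f f - 2 * ip n f g + ip n g g.
Proof.
by rewrite ipBl !(ipC _ _ (f - g)) !ipBl (ipC _ g f); ring.
Qed.

Lemma ipD2 n f g : ip n (f + g) (f + g) = ip n f f + 2 * ip n f g + ip n g g.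
Proof.
by rewrite ipDl !(ipC _ _ (f + g)) !ipDl (ipC _ g f); ring.
Qed.

Lemma ip_bound n f g :
  - (ip n f f + ip n g g) <= ip n f g <= ip n f f + ip n g g.
Proof.
have := ip_ge0 n (f - g); have := ip_ge0 n (f + g); rewrite ipB2 ipD2.
by have := ip_ge0 n f; have := ip_ge0 n g; lra.
Qed.

Lemma ipD_le n f g : ip n (f + g) (f + g) <= 2 * ip n f f + 2 * ip n g g.
Proof. by have := ip_ge0 n (f - g); rewrite ipB2 ipD2; lra. Qed.

Definition bounded_mx f := exists M, forall n, ip n f f <= M.

Lemma bounded_ip f g : bounded_mx f -> bounded_mx g ->
  exists M, forall n, - M <= ip n f g <= M.
Proof.
move=> [M fM] [M' gM']; exists (M + M') => n.
by have := ip_bound n f g; have := fM n; have := gM' n; lra.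
Qed.

Lemma bounded_lin a f g : bounded_mx f -> bounded_mx g -> bounded_mx (a *: f + g).
Proof.
move=> [M fM] [M' gM']; exists (2 * (a ^+ 2 * M) + 2 * M') => n.
apply: le_trans (ipD_le _ _ _) _; apply: lerD; rewrite ler_pM2l//.
by rewrite ipZl ipC ipZl mulrA -expr2 ler_wpM2l// sqr_ge0.
Qed.

Lemma bounded_sub f g : bounded_mx f -> bounded_mx g -> bounded_mx (f - g).
Proof. by move=> bf bg; rewrite addrC -scaleN1r; exact: bounded_lin. Qed.

Definition uform f g : R := ulim U (fun n => ip n f g).

Lemma uform_ge0 f : bounded_mx f -> 0 <= uform f f.
Proof. by case=> M fM; apply: (@ulim_ge0 _ _ _ M) => n; rewrite ip_ge0 fM. Qed.

Lemma uformC f g : uform f g = uform g f.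
Proof. by congr ulim; apply/funext => n; exact: ipC. Qed.

Lemma uform_lin a f g h : bounded_mx f -> bounded_mx g -> bounded_mx h ->
  uform (a *: f + g) h = a * uform f h + uform g h.
Proof.
move=> bf bg bh; have [M fh] := bounded_ip bf bh; have [M' gh] := bounded_ip bg bh.
rewrite /uform -(ulimZ _ a fh) -(@ulimD _ _ _ _ (- (`|a| * M)) (`|a| * M) _ _ _ gh).
  by congr ulim; apply/funext => n; rewrite ip_lin.
move=> n; rewrite -ler_norml normrM ler_wpM2l// ler_norml; exact: fh.
Qed.

Lemma uform_le_near f e : bounded_mx f ->
  (\forall n \near ufilter U, ip n f f <= e) -> uform f f <= e.
Proof. by case=> M fM; apply: (@ulim_le_near _ _ _ 0 M) => n; rewrite ip_ge0 fM. Qed.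

Lemma near_uform_lt f e : bounded_mx f -> uform f f < e ->
  \forall n \near ufilter U, ip n f f < e.
Proof. by case=> M fM; apply: (@near_ulim_lt _ _ _ 0 M) => n; rewrite ip_ge0 fM. Qed.

Definition act s f : mxseq := fun i : {n : nat & ('I_n.+1 * 'I_n.+1)%type} =>
  let: existT n (x, y) := i in f (existT _ n ((s n)^-1%g x, (s n)^-1%g y)).

Lemma entry_act n s f (p : 'I_n.+1 * 'I_n.+1) :
  entry (act s f) p = entry f ((s n)^-1%g p.1, (s n)^-1%g p.2).
Proof. by case: p. Qed.

Lemma act_lin s a f g : act s (a *: f + g) = a *: act s f + act s g.
Proof. by apply/funext => -[n [x y]]. Qed.

Lemma actB s f g : act s (f - g) = act s f - act s g.
Proof. by apply/funext => -[n [x y]]. Qed.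

Lemma act_mul s t f : act s (act t f) = act (mul_seq s t) f.
Proof.
by apply/funext => -[n [x y]]; rewrite /act /mul_seq /= !invMg !permM.
Qed.

Lemma act_one f : act one_seq f = f.
Proof. by apply/funext => -[n [x y]]; rewrite /act /one_seq /= !invg1 !perm1. Qed.

Lemma ip_act n s f g : ip n (act s f) (act s g) = ip n f g.
Proof.
congr (_ / _).
have bij : {on predT, bijective (fun p : 'I_n.+1 * 'I_n.+1 => (s n p.1, s n p.2))}.
  exists (fun p => ((s n)^-1%g p.1, (s n)^-1%g p.2)) => -[x y] _ /=;
    by rewrite ?permK ?permKV.
rewrite (reindex _ bij) /=; apply: eq_bigr => -[x y] _.
by rewrite !entry_act /= !permK.
Qed.

Lemma bounded_act s f : bounded_mx f -> bounded_mx (act s f).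
Proof. by case=> M fM; exists M => n; rewrite ip_act. Qed.

Lemma uform_act s f g : uform (act s f) (act s g) = uform f g.
Proof. by congr ulim; apply/funext => n; rewrite ip_act. Qed.

(** On these sequences the action of permutation sequences factors through the
universal sofic group, which need not be so for all bounded sequences: a
matrix may concentrate its mass on few rows. *)
Definition tame f := bounded_mx f /\ forall s t, dist_seq R U s t = 0 ->
  uform (act s f - act t f) (act s f - act t f) = 0.

End MatrixSequences.

(** * The Hilbert space of tame matrix sequences *)

Lemma invr_small (R : realType) (e : R) : 0 < e -> exists k, k.+1%:R^-1 < e.
Proof. by move=> /ltr_add_invr[k]; rewrite add0r; exists k. Qed.

Section MatrixHilbert.
Variables (R : realType) (U : npUltrafilter).
Implicit Types (f g h : mxseq R) (s t d : perm_seq).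
Local Notation uform := (@uform R U).
Local Notation tame := (@tame R U).
Local Notation bounded_mx := (@bounded_mx R).

Lemma uformD_le f g : bounded_mx f -> bounded_mx g ->
  uform (f + g) (f + g) <= 2 * uform f f + 2 * uform g g.
Proof.
move=> bf bg; have [M fM] := bounded_ip bf bf; have [M' gM] := bounded_ip bg bg.
have bfg : bounded_mx (f + g) by rewrite -[f]scale1r; exact: bounded_lin.
have [M'' fgM] := bounded_ip bfg bfg.
rewrite /uform -(ulimZ U 2 fM) -(ulimZ U 2 gM).
have fM2 n : - (2 * M) <= 2 * ip n f f <= 2 * M by have := fM n; lra.
have gM2 n : - (2 * M') <= 2 * ip n g g <= 2 * M' by have := gM n; lra.
rewrite -(ulimD U fM2 gM2).
apply: (@ulim_le _ _ _ _ _ _ (- (2 * M) - 2 * M') (2 * M + 2 * M') fgM).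
  by move=> n; have := fM2 n; have := gM2 n; lra.
by near=> n; exact: ipD_le.
Unshelve. all: by end_near. Qed.

Lemma uformZ2 a f : bounded_mx f -> uform (a *: f) (a *: f) = a ^+ 2 * uform f f.
Proof.
move=> bf; have [M fM] := bounded_ip bf bf; rewrite /uform -(ulimZ U _ fM).
by congr ulim; apply/funext => n; rewrite ipZl ipC ipZl mulrA expr2.
Qed.

Lemma uformBC f g : uform (f - g) (f - g) = uform (g - f) (g - f).
Proof. by congr ulim; apply/funext => n; rewrite !ipB2 (ipC n g f); ring. Qed.

Lemma uformB_le g f h : bounded_mx f -> bounded_mx g -> bounded_mx h ->
  uform (f - h) (f - h) <= 2 * uform (f - g) (f - g) + 2 * uform (g - h) (g - h).
Proof.
move=> bf bg bh; have -> : f - h = (f - g) + (g - h) by rewrite addrA subrK.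
by apply: uformD_le; exact: bounded_sub.
Qed.

(** Tameness survives limits because the action is isometric. *)
Lemma uform_act_close s t f g : tame g -> bounded_mx f -> dist_seq R U s t = 0 ->
  uform (act s f - act t f) (act s f - act t f) <= 6 * uform (f - g) (f - g).
Proof.
move=> [bg gst] bf st; have bsf := bounded_act s bf; have btf := bounded_act t bf.
have bsg := bounded_act s bg; have btg := bounded_act t bg.
have := uformB_le bsf bsg btf; have := uformB_le bsg btg btf.
rewrite -!actB !uform_act gst// (uformBC g f); lra.
Qed.

(** A diagonal argument.  For a fast subsequence g of u, the estimate
[A j n] says that at index n the matrices g 0, ..., g j satisfy the Cauchy
bounds; it holds for almost all n when j is fixed.  The limit takes at index n the
matrix g j for the largest admissible j <= n. *)
Lemma mxseq_complete (u : nat -> mxseq R) : (forall k, tame (u k)) ->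
  (forall e, 0 < e -> exists N, forall m n, (N <= m)%N -> (N <= n)%N ->
     uform (u m - u n) (u m - u n) < e) ->
  exists2 l, tame l & forall e, 0 < e -> exists N, forall n, (N <= n)%N ->
     uform (u n - l) (u n - l) < e.
Proof.
move=> du Cu; have bu k : bounded_mx (u k) := (du k).1.
have e0 j : 0 < j.+1%:R^-1 :> R by rewrite invr_gt0 ltr0n.
have /choice[N NP] := fun j => Cu _ (e0 j).
pose N' j := (\max_(i < j.+1) N i)%N.
have N'N i j : (i <= j)%N -> (N i <= N' j)%N.
  move=> ij; have ij' : (i < j.+1)%N by [].
  exact: (@leq_bigmax_cond _ predT (fun i : 'I_j.+1 => N i) (Ordinal ij')).
pose g j := u (N' j).
have gg i j : (i <= j)%N -> uform (g i - g j) (g i - g j) < i.+1%:R^-1.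
  by move=> ij; apply: NP; exact: N'N.
pose A j n := [forall i : 'I_j.+1, ip n (g i - g j) (g i - g j) < i.+1%:R^-1].
have A0 n : A 0%N n.
  apply/forallP => -[[|//] /= _]; rewrite subrr.
  have -> : ip n (0 : mxseq R) 0 = 0 by rewrite -(scale0r 0) ipZl mul0r.
  by [].
pose J n := (\max_(j < n.+1 | A j n) j)%N.
have AJ n : A (J n) n.
  have [|j Aj Jj] := @eq_bigmax_cond _ [pred j : 'I_n.+1 | A j n] (@nat_of_ord n.+1).
    by apply/card_gt0P; exists ord0; rewrite inE A0.
  by rewrite /J (_ : (\max_(j < n.+1 | A j n) j)%N = j) //.
have leJ j n : (j <= n)%N -> A j n -> (j <= J n)%N.
  move=> jn Aj; have jn' : (j < n.+1)%N by [].
  exact: (@leq_bigmax_cond _ [pred j : 'I_n.+1 | A j n] (@nat_of_ord n.+1) (Ordinal jn')).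
pose l : mxseq R := fun i => let: existT n p := i in entry (g (J n)) p.
have lE n h : ip n (h - l) (h - l) = ip n (h - g (J n)) (h - g (J n)) by [].
have gl j n : (j <= n)%N -> A j n -> ip n (g j - l) (g j - l) < j.+1%:R^-1.
  move=> jn Ajn; have jJ := leJ _ _ jn Ajn; rewrite lE.
  have jJ' : (j < (J n).+1)%N by [].
  by have /forallP/(_ (Ordinal jJ')) := AJ n.
have bl : bounded_mx l.
  have [M gM] := bu (N' 0%N); exists (2 * (M + 1)) => n.
  have ->: ip n l l = ip n (g (J n)) (g (J n)) by [].
  have -> : g (J n) = g 0%N + (g (J n) - g 0%N) by rewrite addrC subrK.
  apply: le_trans (ipD_le _ _ _) _; rewrite -mulrDr ler_wpM2l// lerD//.
  have := gl 0%N n isT (A0 n); rewrite lE invr1 !ipB2 (ipC n (g 0%N)); lra.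
have gl' j : uform (g j - l) (g j - l) <= j.+1%:R^-1.
  apply: uform_le_near; first exact: bounded_sub (bu _) bl.
  have Aj : \forall n \near ufilter U, A j n.
    have : \forall n \near ufilter U, forall i : 'I_j.+1,
        ip n (g i - g j) (g i - g j) < i.+1%:R^-1.
      apply: filter_forall => i; apply: near_uform_lt.
        by apply: bounded_sub; exact: bu.
      by apply: gg; rewrite -ltnS.
    by apply: filterS => n; move/forallP.
  by apply: filterS2 (uf_ge U j) Aj => n jn Ajn; apply/ltW/gl.
exists l.
  split=> // s t st; apply/eqP; rewrite eq_le uform_ge0 ?andbT; last first.
    by apply: bounded_sub; exact: bounded_act.
  apply/ler_addgt0Pr => e ep; rewrite add0r.
  have [|j je] := @invr_small R (e / 6); first by rewrite divr_gt0.
  have := uform_act_close (du (N' j)) bl st; have := gl' j.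
  move: je; rewrite (uformBC l) -/(g j); move: j.+1%:R^-1 => c; lra.
move=> e ep; have [|j je] := @invr_small R (e / 4); first by rewrite divr_gt0.
exists (N' j) => n Nn.
have := uformB_le (bu n) (bu (N' j)) bl; have := gl' j.
have := NP j n (N' j) (leq_trans (N'N j j (leqnn j)) Nn) (N'N j j (leqnn j)).
move: je; rewrite -/(g j); move: j.+1%:R^-1 => c; lra.
Qed.

Fact tame0 : tame 0.
Proof.
have i0 n : ip n (0 : mxseq R) 0 = 0 by rewrite -(scale0r 0) ipZl mul0r.
split=> [|s t _]; first by exists 0 => n; rewrite i0.
have a0 s' : act s' 0 = 0 :> mxseq R by apply/funext => -[n [x y]].
rewrite !a0 subr0; apply: ulim_near; near=> n; exact: i0.
Unshelve. all: by end_near. Qed.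

Fact tame_lin a f g : tame f -> tame g -> tame (a *: f + g).
Proof.
move=> [bf fst] [bg gst]; split=> [|s t st]; first exact: bounded_lin.
have bsf := bounded_sub (bounded_act s bf) (bounded_act t bf).
have bsg := bounded_sub (bounded_act s bg) (bounded_act t bg).
have -> : act s (a *: f + g) - act t (a *: f + g) =
    a *: (act s f - act t f) + (act s g - act t g).
  by rewrite !act_lin opprD addrACA scalerBr.
have bl := bounded_lin a bsf bsg.
apply/eqP; rewrite eq_le uform_ge0 ?andbT//.
have baf : bounded_mx (a *: (act s f - act t f)).
  by rewrite -[_ *: _]addr0; apply: bounded_lin => //; exact: tame0.1.
by have := uformD_le baf bsg; rewrite uformZ2// fst// gst// !mulr0 addr0.
Qed.

Definition mx_hilbert : semiHilbert R :=
  @SemiHilbert R (mxseq R) tame uform tame0 tame_lin (@uformC R U)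
    (fun a f g h df dg dh => uform_lin U a df.1 dg.1 dh.1)
    (fun f df => uform_ge0 U df.1) mxseq_complete.

End MatrixHilbert.

(** * Thresholds and completions of partial injections *)

(** Bisection: the two middle quarters of an interval are disjoint, so one of
them receives at most half of the values of f that lie in the interval.  Any t
in it is at distance l/4 from the complement of the interval, and the argument
is repeated in this quarter. *)
Lemma threshold (R : realFieldType) (T : finType) (f : T -> R) (N : nat) (a l : R) :
  0 < l -> exists2 t, a <= t <= a + l & forall k, (k < N)%N ->
  (#|[pred p | (`|f p - t| < l / 4 ^+ k.+1)%R]| * 2 ^ k <=
   #|[pred p | (a <= f p < a + l)%R]|)%N.
Proof.
elim: N a l => [|N IH] a l l0; first by exists a => //; lra.
pose I b := [pred p : T | (b <= f p < b + l / 4)%R].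
have l4 : 0 < l / 4 by rewrite divr_gt0.
have step b : a + l / 4 <= b <= a + l / 2 ->
    (#|I b| * 2 <= #|[pred p | (a <= f p < a + l)%R]|)%N ->
    exists2 t, a <= t <= a + l & forall k, (k < N.+1)%N ->
      (#|[pred p | (`|f p - t| < l / 4 ^+ k.+1)%R]| * 2 ^ k <=
       #|[pred p | (a <= f p < a + l)%R]|)%N.
  move=> ab Ib; have [t bt tP] := IH b _ l4; exists t; first lra.
  case=> [_|k]; last first.
    rewrite ltnS => /tP; rewrite expnSr mulnA => h.
    apply: leq_trans Ib; rewrite leq_mul2r /=; apply: leq_trans h.
    rewrite leq_mul2r; apply/orP; right; apply/subset_leq_card/fintype.subsetP => p.
    by rewrite !inE (exprS 4 k.+1) invfM mulrA.
  rewrite muln1; apply/subset_leq_card/fintype.subsetP => p.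
  by rewrite !inE expr1 ltr_distl; lra.
have disj : (#|I (a + l / 4)%R| + #|I (a + l / 2)%R| <=
    #|[pred p | (a <= f p < a + l)%R]|)%N.
  rewrite -cardUI [X in (_ + X)%N](_ : _ = 0%N) ?addn0; last first.
    by apply: eq_card0 => p; rewrite !inE; apply/negP; lra.
  by apply/subset_leq_card/fintype.subsetP => p; rewrite !inE; lra.
have [h|h] := leqP #|I (a + l / 4)%R| #|I (a + l / 2)%R|.
  by apply: (step (a + l / 4)); [lra|lia].
by apply: (step (a + l / 2)); [lra|lia].
Qed.

(** A partial injection p of X, with partial inverse p', is completed to a
permutation by sending each point outside the domain to the end of its backward
orbit under p.  This choice is canonical, so it commutes with the symmetries of
p, and does so approximately for approximate symmetries. *)
Section Completion.
Variables (X : finType) (p p' : X -> option X).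
Hypothesis pp' : forall x y, p x = Some y <-> p' y = Some x.
Implicit Types (x y z : X).

Definition back x := odflt x (p' x).

Definition unstopped x j := [forall i : 'I_j, p' (iter i back x) != None].

Lemma unstoppedP x j i : unstopped x j -> (i < j)%N ->
  p' (iter i back x) = Some (iter i.+1 back x).
Proof.
move=> /forallP/[swap] ij /(_ (Ordinal ij)) /=.
by rewrite /back; case: (p' _).
Qed.

Lemma unstopped_le x i j : (i <= j)%N -> unstopped x j -> unstopped x i.
Proof.
move=> ij /forallP h; apply/forallP => -[k ki].
exact: (h (Ordinal (leq_trans ki ij))).
Qed.

(** The backward orbits of distinct points outside the domain are disjoint, and
none of them has repetitions. *)
Lemma back_inj i j x x' : p x = None -> p x' = None ->
  unstopped x i -> unstopped x' j ->
  iter i back x = iter j back x' -> i = j /\ x = x'.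
Proof.
move=> px px'; elim: i j => [|i IH] [|j] //.
- move=> _ /unstoppedP/(_ (ltnSn _)) h xE; move: h; rewrite -xE => /pp'.
  by rewrite /= px.
- move=> /unstoppedP/(_ (ltnSn _)) h _ xE; move: h; rewrite xE => /pp'.
  by rewrite /= px'.
move=> ui uj; have hi := unstoppedP ui (ltnSn _); have hj := unstoppedP uj (ltnSn _).
move=> E; rewrite -E in hj.
have iE : iter i back x = iter j back x'.
  by move/pp': hi => hi; move/pp': hj; rewrite hi => -[].
by have [-> ->] := IH _ (unstopped_le (leqnSn _) ui) (unstopped_le (leqnSn _) uj) iE.
Qed.

Lemma unstopped_card x j : p x = None -> unstopped x j -> (j < #|X|)%N.
Proof.
move=> px uj; pose h (i : 'I_j.+1) := iter i back x.
have hinj : injective h.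
  move=> a b /back_inj ab; apply: val_inj.
  by case: (ab px px) => //; apply: unstopped_le uj; rewrite -ltnS.
by have := leq_card h hinj; rewrite card_ord.
Qed.

Lemma stop_time x : p x = None -> exists2 i, unstopped x i & p' (iter i back x) = None.
Proof.
move=> px; have ex : exists i, ~~ unstopped x i.
  by exists #|X|; apply/negP => /(unstopped_card px); rewrite ltnn.
case: (ex_minnP ex) => -[|i] ui mini; first by case/forallP: ui => -[].
have ui' : unstopped x i by apply: contraT => /mini; rewrite ltnn.
exists i => //; case E : p' => [y|] //; case/negP: ui.
apply/forallP => -[k /=]; rewrite ltnS leq_eqVlt => /orP[/eqP ->|ki].
  by rewrite E.
by have /forallP/(_ (Ordinal ki)) := ui'.
Qed.

Lemma back_stop x i m : (i <= m)%N -> p' (iter i back x) = None ->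
  iter m back x = iter i back x.
Proof.
move=> im pi; rewrite -(subnK im) iterD; elim: (m - i)%N => //= k ->.
by rewrite /back pi.
Qed.

Definition complete_fun x := odflt (iter #|X| back x) (p x).

Lemma complete_stop x i : p x = None -> unstopped x i -> p' (iter i back x) = None ->
  complete_fun x = iter i back x.
Proof.
move=> px ui pi; rewrite /complete_fun px /=; apply: back_stop => //.
exact/ltnW/(unstopped_card px).
Qed.

Lemma complete_fun_inj : injective complete_fun.
Proof.
move=> x x'; case px : (p x) => [y|]; case px' : (p x') => [y'|].
- rewrite /complete_fun px px' /= => yE; move: px px'; rewrite yE.
  by move=> /pp' px /pp'; rewrite px => -[].
- have [i ui pi] := stop_time px'; rewrite (complete_stop px' ui pi).
  by rewrite /complete_fun px /= => yE; move/pp': px; rewrite yE pi.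
- have [i ui pi] := stop_time px; rewrite (complete_stop px ui pi).
  by rewrite /complete_fun px' /= => yE; move/pp': px'; rewrite -yE pi.
have [i ui pi] := stop_time px; rewrite (complete_stop px ui pi).
have [j uj pj] := stop_time px'; rewrite (complete_stop px' uj pj).
by move=> /(back_inj px px' ui uj)[].
Qed.

Definition completion : {perm X} := perm complete_fun_inj.

Lemma completion_Some x y : p x = Some y -> completion x = y.
Proof. by move=> px; rewrite permE /complete_fun px. Qed.

Variable c : {perm X}.
Let B : {set X} := [set x | p (c x) != omap c (p x)]%SET.
Let B' : {set X} := [set y | p' (c y) != omap c (p' y)]%SET.

Lemma back_equivariant x i : unstopped x i ->
  (forall j, (j < i)%N -> iter j back x \notin B') ->
  iter i back (c x) = c (iter i back x) /\ unstopped (c x) i.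
Proof.
elim: i => [|i IH] ui nB; first by split=> //; apply/forallP => -[].
have [j ji|IHi uci] := IH (unstopped_le (leqnSn _) ui) _; first by apply: nB; exact: ltnW.
have := nB i (ltnSn _); rewrite inE negbK => /eqP; rewrite (unstoppedP ui)// => pc.
split; first by rewrite /= IHi {1}/back pc.
apply/forallP => -[k /=]; rewrite ltnS leq_eqVlt => /orP[/eqP ->|ki].
  by rewrite IHi pc.
by have /forallP/(_ (Ordinal ki)) := uci.
Qed.

(** If c fails to commute with the completion at x, then c fails to commute with
p at x, or with p' at one of the first K points of the backward orbit of x, or
that orbit has more than K points.  By [back_inj] each point of X is the j-th
point of at most one orbit, whence the bound on the second case, and there are
at most #|X| / K orbits of the third kind. *)
Lemma completion_equivariant K :
  (K * #|[pred x | (completion (c x) != c (completion x))]| <=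
   K * #|B| + K * (K * #|B'|) + #|X|)%N.
Proof.
pose B2 (j : 'I_K) : {set X} := [set x | [&& p x == None, unstopped x j & iter j back x \in B']]%SET.
pose B3 : {set X} := [set x | (p x == None) && unstopped x K]%SET.
have sub : [pred x | (completion (c x) != c (completion x))]
    \subset B :|: (\bigcup_j B2 j)%SET :|: B3.
  apply/fintype.subsetP => x; rewrite inE; apply: contraR.
  rewrite !finset.in_setU !negb_or => /andP[/andP[xB xB2] xB3].
  move: xB; rewrite inE negbK => /eqP pcx.
  case px : (p x) => [y|] in pcx *.
    by rewrite (completion_Some px) (completion_Some pcx).
  rewrite /= in pcx; have [i ui pi] := stop_time px.
  have iK : (i < K)%N.
    rewrite ltnNge; apply: contra xB3 => Ki.
    by rewrite inE px eqxx; exact: unstopped_le ui.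
  have nB j : (j <= i)%N -> iter j back x \notin B'.
    move=> ji; apply: contra xB2 => jB; apply/finset.bigcupP.
    exists (Ordinal (leq_ltn_trans ji iK)) => //.
    by rewrite inE px eqxx jB (unstopped_le ji ui).
  have [ci uci] := back_equivariant ui (fun j ji => nB j (ltnW ji)).
  have pci : p' (iter i back (c x)) = None.
    by have := nB i (leqnn i); rewrite inE negbK ci => /eqP ->; rewrite pi.
  by rewrite !permE (complete_stop px ui pi) (complete_stop pcx uci pci) ci.
have cB2 j : (#|B2 j| <= #|B'|)%N.
  rewrite -(@card_in_imset _ _ (iter j back)).
    apply/subset_leq_card/fintype.subsetP => _ /imsetP[x + ->].
    by rewrite inE => /and3P[].
  move=> x x'; rewrite !inE => /and3P[/eqP px ux _] /and3P[/eqP px' ux' _].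
  by move=> /(back_inj px px' ux ux')[].
have cB3 : (K * #|B3| <= #|X|)%N.
  rewrite -{1}[K]card_ord -[#|{: 'I_K}|]cardsT -finset.cardsX.
  rewrite -(@card_in_imset _ _ (fun ix : 'I_K * X => iter ix.1 back ix.2)).
    exact: max_card.
  move=> [i x] [j x']; rewrite !inE /= => /andP[/eqP px ux] /andP[/eqP px' ux'].
  move=> /(back_inj px px' (unstopped_le (ltnW (ltn_ord i)) ux)
    (unstopped_le (ltnW (ltn_ord j)) ux'))[ij ->].
  by congr pair; exact: val_inj.
have cU : (#|(\bigcup_j B2 j)%SET| <= K * #|B'|)%N.
  rewrite (_ : K * _ = \sum_(j < K) #|B'|)%N; last by rewrite sum_nat_const card_ord.
  have leUs : (#|(\bigcup_j B2 j)%SET| <= \sum_j #|B2 j|)%N.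
    elim/big_rec2: _ => [|j A m _ h]; first by rewrite finset.cards0.
    by apply: leq_trans (leq_card_setU _ _) _; rewrite leq_add2l.
  by apply: leq_trans leUs _; apply: leq_sum.
apply: (leq_trans (leq_mul (leqnn K) (subset_leq_card sub))).
apply: (leq_trans (leq_mul (leqnn K) (leq_card_setU _ _))).
rewrite mulnDr leq_add//.
apply: (leq_trans (leq_mul (leqnn K) (leq_card_setU _ _))).
by rewrite mulnDr leq_add2l leq_mul2l cU orbT.
Qed.

End Completion.

(** * Permutations from relations *)

Section IsolatedEntries.
Variable X : finType.
Implicit Types (M : rel X) (c : {perm X}) (x y : X).

(** The pairs of M that share no coordinate with another pair of M form the
graph of a partial injection. *)
Definition isolated M x y := [&& M x y, [forall z, M x z ==> (z == y)] &
  [forall z, M z y ==> (z == x)]].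

Definition transpose M : rel X := fun x y => M y x.

Lemma isolated_transpose M x y : isolated (transpose M) x y = isolated M y x.
Proof. by rewrite /isolated /transpose andbCA andbC -andbA andbC -andbA. Qed.

Definition partner M x := [pick y | isolated M x y].

Lemma partnerP M x y : partner M x = Some y <-> isolated M x y.
Proof.
rewrite /partner; case: pickP => [z xz|nz]; last by rewrite nz.
split=> [[<-]//|/and3P[xy _ _]]; congr Some; apply/eqP; rewrite eq_sym.
by case/and3P: xz => _ /forallP/(_ y)/implyP/(_ xy).
Qed.

Lemma partner_transpose M x y :
  partner M x = Some y <-> partner (transpose M) y = Some x.
Proof. by rewrite !partnerP isolated_transpose. Qed.

Definition discrepancy M c := [set xy | M (c xy.1) (c xy.2) != M xy.1 xy.2]%SET.

Lemma isolated_perm M c x y : (forall z, M (c x) (c z) = M x z) ->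
  (forall z, M (c z) (c y) = M z y) -> isolated M (c x) (c y) = isolated M x y.
Proof.
move=> rx cy; rewrite /isolated rx; congr [&& _, _ & _].
  apply/forallP/forallP => h z; first by rewrite -rx -(inj_eq (@perm_inj _ c)).
  by have := h (c^-1 z)%g; rewrite -rx -(inj_eq (@perm_inj _ c)) permKV.
apply/forallP/forallP => h z; first by rewrite -cy -(inj_eq (@perm_inj _ c)).
by have := h (c^-1 z)%g; rewrite -cy -(inj_eq (@perm_inj _ c)) permKV.
Qed.

(** A point x where the partner is not equivariant lies in a row of a
discrepancy, or is the partner of a column of a discrepancy, or is sent by c to
such a partner: three images of the set of discrepancies. *)
Lemma partner_perm M c :
  (#|[set x | partner M (c x) != omap c (partner M x)]%SET| <= 3 * #|discrepancy M c|)%N.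
Proof.
set D := discrepancy M c; pose p' := partner (transpose M).
pose f2 (xy : X * X) := odflt xy.1 (p' xy.2).
pose f3 (xy : X * X) := (c^-1 (odflt xy.1 (p' (c xy.2))))%g.
apply: (@leq_trans #|(fst @: D :|: f2 @: D :|: f3 @: D)%SET|).
  apply/subset_leq_card/fintype.subsetP => x; rewrite inE; apply: contraR.
  rewrite !finset.in_setU !negb_or => /andP[/andP[x1 x2] x3].
  have D0 (f : X * X -> X) xy : f xy \notin (f @: D)%SET -> M (c xy.1) (c xy.2) = M xy.1 xy.2.
    move=> fD; apply/eqP; apply: contraNT fD => nxy.
    by apply: imset_f; rewrite inE.
  have row z : M (c x) (c z) = M x z := D0 fst (x, z) x1.
  case px : (partner M x) => [y|] /=.
    apply/eqP/partnerP; rewrite isolated_perm//; first exact/partnerP.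
    move=> z; apply: (D0 f2 (z, y)); move: px => /partner_transpose.
    by rewrite /f2 /p' /= => ->.
  case pcx : (partner M (c x)) => [y'|] //.
  have yE : y' = c (c^-1 y')%g by rewrite permKV.
  rewrite yE in pcx; move/partnerP: (pcx); rewrite isolated_perm//; last first.
    move=> z; apply: (D0 f3 (z, (c^-1 y')%g)); move: pcx => /partner_transpose.
    by rewrite /f3 /p' /= => ->; rewrite /= permK.
  by move/partnerP; rewrite px.
have h f := leq_imset_card f D.
apply: leq_trans (leq_card_setU _ _) _; rewrite mulSnr leq_add//.
apply: leq_trans (leq_card_setU _ _) _; rewrite mulSnr leq_add//.
by rewrite mul1n.
Qed.

Lemma discrepancy_transpose M c : #|discrepancy (transpose M) c| = #|discrepancy M c|.
Proof.
have swap_inj : injective (fun xy : X * X => (xy.2, xy.1)) by move=> [? ?] [? ?] [-> ->].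
rewrite -(card_imset _ swap_inj); apply: eq_card => -[x y].
apply/imsetP/idP => [[[x' y'] + [-> ->]]|]; first by rewrite !inE.
by rewrite inE => xy; exists (y, x) => //; rewrite inE.
Qed.

(** A permutation attached to M in a canonical way, equal to d when M is the
graph of d. *)
Definition round_perm M : {perm X} := completion (partner_transpose M).

Lemma round_perm_equivariant M c K :
  (K * #|[pred x | round_perm M (c x) != c (round_perm M x)]| <=
   (3 * K + 3 * (K * K)) * #|discrepancy M c| + #|X|)%N.
Proof.
apply: leq_trans (completion_equivariant _ c K) _; rewrite leq_add2r.
have h := leq_mul (leqnn K) (partner_perm M c).
have := leq_mul (leqnn K) (leq_mul (leqnn K) (partner_perm (transpose M) c)).
rewrite discrepancy_transpose; move: h; nia.
Qed.

Lemma round_perm_close M (d : {perm X}) :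
  (#|[pred x | (d x != round_perm M x)]| <= 2 * #|[set xy | M xy.1 xy.2 != (xy.2 == d xy.1)]%SET|)%N.
Proof.
set D := [set xy | _]%SET; pose f (xy : X * X) := (d^-1 xy.2)%g.
apply: (@leq_trans #|(fst @: D :|: f @: D)%SET|); last first.
  by apply: leq_trans (leq_card_setU _ _) _; rewrite mul2n -addnn leq_add// leq_imset_card.
apply/subset_leq_card/fintype.subsetP => x; rewrite inE; apply: contraR.
rewrite finset.in_setU negb_or => /andP[x1 x2].
have D0 (g : X * X -> X) xy : g xy \notin (g @: D)%SET -> M xy.1 xy.2 = (xy.2 == d xy.1).
  by move=> gD; apply/eqP; apply: contraNT gD => nxy; apply: imset_f; rewrite inE.
have row z : M x z = (z == d x) := D0 fst (x, z) x1.
have col z : M z (d x) = (d x == d z).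
  by apply: (D0 f (z, d x)); rewrite /f /= permK.
rewrite (completion_Some _ (y := d x))//; apply/partnerP/and3P; split.
- by rewrite row.
- by apply/forallP => z; rewrite row; apply/implyP.
- by apply/forallP => z; rewrite col (inj_eq perm_inj) eq_sym; apply/implyP.
Qed.

End IsolatedEntries.

(** * Rounding an invariant matrix to a permutation *)

Section Graphs.
Variables (R : realType) (U : npUltrafilter).
Implicit Types (f g : mxseq R) (s t a b d : perm_seq).
Local Notation uform := (@uform R U).
Local Notation tame := (@tame R U).
Local Notation bounded_mx := (@bounded_mx R).
Local Notation dist := (dist_seq R U).

Lemma dist_seq_eq0 a b : (forall e : R, 0 < e ->
  \forall n \near ufilter U, hamming R (a n) (b n) <= e) -> dist a b = 0.
Proof.
move=> ab; apply/eqP; rewrite eq_le dist_seq_ge0 andbT.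
apply/ler_addgt0Pr => e e0; rewrite add0r.
by apply: (@ulim_le_near _ _ _ 0 1) => [n|]; [exact: hamming_bnd|exact: ab].
Qed.

Definition graph d : mxseq R := fun i : {n : nat & ('I_n.+1 * 'I_n.+1)%type} =>
  let: existT n (x, y) := i in (y == d n x)%:R.

Lemma ip_graph n a b : ip n (graph a) (graph b) = 1 - hamming R (a n) (b n).
Proof.
have n0 : n.+1%:R != 0 :> R by rewrite pnatr_eq0.
apply: (mulIf n0); rewrite /ip /hamming divfK// mulrBl divfK// mul1r.
apply/eqP; rewrite -subr_eq opprK; apply/eqP.
have -> : \sum_(p : 'I_n.+1 * 'I_n.+1) entry (graph a) p * entry (graph b) p =
    \sum_(x < n.+1) \sum_(y < n.+1) entry (graph a) (x, y) * entry (graph b) (x, y).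
  by rewrite pair_bigA; apply: eq_bigr => -[].
transitivity (\sum_(x : 'I_n.+1) (1 : R)); last first.
  by rewrite sumr_const card_ord.
rewrite -sum1_card natr_sum /= [X in _ + X]big_mkcond -big_split /=; apply: eq_bigr => x _.
rewrite (bigD1 (a n x))//= big1 ?addr0.
  by rewrite /entry /= eqxx mul1r inE; case: eqP => _; rewrite ?addr0 ?add0r.
by move=> y /negbTE; rewrite /entry /= => ->; rewrite mul0r.
Qed.

Lemma ip_graph_sub n a b :
  ip n (graph a - graph b) (graph a - graph b) = 2 * hamming R (a n) (b n).
Proof. by rewrite ipB2 !ip_graph !hammingxx; ring. Qed.

Lemma bounded_graph d : bounded_mx (graph d).
Proof. by exists 1 => n; rewrite ip_graph hammingxx subr0. Qed.

Lemma uform_graph_sub a b :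
  uform (graph a - graph b) (graph a - graph b) = 2 * dist a b.
Proof.
have h n : 0 <= hamming R (a n) (b n) <= 1 := hamming_bnd R (a n) (b n).
by rewrite -(ulimZ U 2 h); congr ulim; apply/funext => n; exact: ip_graph_sub.
Qed.

Lemma act_graph s d : act s (graph d) = graph (mul_seq s (mul_seq d (inv_seq s))).
Proof.
apply/funext => -[n [x y]]; rewrite /act /graph /mul_seq /inv_seq !permM.
by congr (_%:R); rewrite -(inj_eq (@perm_inj _ (s n))) permKV.
Qed.

Lemma dist_mull a s t : dist (mul_seq a s) (mul_seq a t) = dist s t.
Proof. by congr ulim; apply/funext => n; rewrite hamming_mulr. Qed.

Lemma dist_mulr a s t : dist (mul_seq s a) (mul_seq t a) = dist s t.
Proof. by congr ulim; apply/funext => n; rewrite hamming_mull. Qed.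

Lemma dist_inv s t : dist (inv_seq s) (inv_seq t) = dist s t.
Proof. by congr ulim; apply/funext => n; rewrite hamming_inv. Qed.

(** Moving the graph of d by s measures the commutator of d and s. *)
Lemma dist_conj s d :
  dist d (mul_seq s (mul_seq d (inv_seq s))) = dist (mul_seq d s) (mul_seq s d).
Proof.
rewrite -(dist_mulr s); congr ulim; apply/funext => n; congr hamming.
by rewrite /mul_seq /inv_seq -!mulgA mulKVg.
Qed.

Lemma tame_graph d : tame (graph d).
Proof.
split=> [|s t st]; first exact: bounded_graph.
rewrite !act_graph uform_graph_sub; apply/eqP; rewrite mulf_eq0 pnatr_eq0 /=.
rewrite eq_le dist_seq_ge0 andbT.
apply: le_trans (dist_seq_triangle R U (mul_seq t (mul_seq d (inv_seq s))) _ _) _.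
by rewrite dist_mulr st dist_mull dist_mull dist_inv st addr0.
Qed.

(** The discrepancies of f along s are read off [act (inv_seq s) f]. *)
Lemma uform_act_inv s f : bounded_mx f ->
  uform (act s f - f) (act s f - f) = 0 ->
  uform (act (inv_seq s) f - f) (act (inv_seq s) f - f) = 0.
Proof.
move=> bf sf; rewrite -(uform_act U s) actB act_mul.
have -> : mul_seq s (inv_seq s) = one_seq.
  by apply: functional_extensionality_dep => n; rewrite /mul_seq /inv_seq mulVg.
by rewrite act_one uformBC.
Qed.

(** The Chebyshev inequality for the entries of a matrix. *)
Lemma card_entry_le n g (P : pred ('I_n.+1 * 'I_n.+1)) (e : R) :
  (forall p, P p -> e <= entry g p ^+ 2) ->
  #|P|%:R * e <= n.+1%:R * ip n g g.
Proof.
move=> Pe; rewrite /ip [leRHS]mulrC divfK ?pnatr_eq0// mulr_natl -sumr_const.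
rewrite [leLHS]big_mkcond /=; apply: ler_sum => p _.
by case: ifP => [/Pe|_]; rewrite -expr2 ?sqr_ge0.
Qed.

(** At each index the matrix f is turned into the relation [level n < f], then
into a permutation.  The level has to be chosen so that the relation is almost
invariant under all elements of Gam at once: [level_sparse] bounds the number
of entries close to the level at the first n scales, and an entry that is not close to
the level can only cross it under s if s moves it much. *)
Section Rounding.
Variables (Gam : set perm_seq) (f : mxseq R) (d : perm_seq) (r : R).
Hypothesis bf : bounded_mx f.
Hypothesis f_inv : forall s, Gam s -> uform (act s f - f) (act s f - f) = 0.
Hypothesis f_close : uform (graph d - f) (graph d - f) <= r.

Let third_gt0 : 0 < 3^-1 :> R. Proof. by rewrite invr_gt0. Qed.

Let level n : R :=
  sval (cid2 (@threshold R _ (@entry R f n) n 3^-1 3^-1 third_gt0)).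

Let level_bnd n : 3^-1 <= level n <= 3^-1 + 3^-1.
Proof. by rewrite /level; case: cid2. Qed.

Let level_sparse n k : (k < n)%N ->
  #|[pred p : 'I_n.+1 * 'I_n.+1 | (`|entry f p - level n| < 3^-1 / 4 ^+ k.+1)%R]|%:R * 2 ^+ k
    <= n.+1%:R * (9 * ip n f f).
Proof.
move=> kn; rewrite /level; case: cid2 => /= t tb /(_ k kn).
rewrite -(ler_nat R) natrM natrX => /le_trans; apply.
(* All values counted are at least 1/3, so there are at most 9 (n+1) ip f f. *)
rewrite mulrCA -ler_pdivrMl// mulrC; apply: card_entry_le => p /= /andP[h _].
have : (3^-1 : R) ^+ 2 <= entry f p ^+ 2 by rewrite lerXn2r// ?nnegrE; lra.
by apply: le_trans; rewrite expr2; lra.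
Qed.

Let rel_of n : rel 'I_n.+1 := fun x y => level n < entry f (x, y).

Let rounded : perm_seq := fun n => round_perm (@rel_of n).

(** As 1/3 <= level n <= 2/3, the relation and the graph of d differ only at
entries where f and the graph differ by at least 1/3. *)
Let rounded_close : dist d rounded <= 18 * r.
Proof.
have bg := bounded_sub (bounded_graph d) bf.
have [M gM] := bounded_ip bg bg.
apply: (@le_trans _ _ (18 * uform (graph d - f) (graph d - f))); last by rewrite ler_pM2l.
rewrite /uform -(ulimZ U _ gM).
have h n : 0 <= hamming R (d n) (rounded n) <= 1 := hamming_bnd _ _ _.
have gM' n : 18 * - M <= 18 * ip n (graph d - f) (graph d - f) <= 18 * M.
  by have := gM n; lra.
apply: (ulim_le h gM'); near=> n.
rewrite /hamming ler_pdivrMr ?ltr0n//.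
pose D := [set xy : 'I_n.+1 * 'I_n.+1 | rel_of xy.1 xy.2 != (xy.2 == d n xy.1)]%SET.
apply: (@le_trans _ _ (2 * #|D|)%:R); first by rewrite ler_nat; exact: round_perm_close.
rewrite natrM -ler_pdivlMl//.
rewrite (_ : 2^-1 * _ = n.+1%:R * ip n (graph d - f) (graph d - f) * 9); last by field.
rewrite -ler_pdivrMr//; apply: card_entry_le => -[x y] xyD.
have : (x, y) \in D by [].
rewrite inE /= /rel_of entryB.
have := level_bnd n; rewrite [entry (graph d) _]/entry /=.
move: (entry f (x, y)) (level n) => u t tb.
by case: (y == d n x) => /=; case: (ltP t u) => //= tu _; nra.
Unshelve. all: by end_near. Qed.

Let rel_of_discrepancy s (e : R) : Gam s -> 0 < e ->
  \forall n \near ufilter U, #|discrepancy (@rel_of n) (s n)|%:R <= n.+1%:R * e.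
Proof.
move=> Gs e0; have [M fM] := bf.
have M0 : 0 <= M := le_trans (ip_ge0 0 f) (fM 0%N).
have [|k ke] := @invr_small R (e / 2 / (9 * M + 1)).
  by rewrite !divr_gt0//; lra.
(* An entry crosses the level only if it is tau-close to it (P1), which is rare
   by the choice of k, or if it moves by at least tau (P2), which is rare by the
   invariance of f. *)
pose tau : R := 3^-1 / 4 ^+ k.+1.
have tau0 : 0 < tau by rewrite divr_gt0// ?exprn_gt0// invr_gt0.
have bs := bounded_sub (bounded_act (inv_seq s) bf) bf.
have small : \forall n \near ufilter U,
    ip n (act (inv_seq s) f - f) (act (inv_seq s) f - f) < tau ^+ 2 * (e / 2).
  apply: near_uform_lt => //; rewrite uform_act_inv//; last exact: f_inv.
  by rewrite mulr_gt0 ?exprn_gt0// divr_gt0.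
apply: filterS2 small (uf_ge U k.+1) => n small kn.
pose P1 := [pred p : 'I_n.+1 * 'I_n.+1 | (`|entry f p - level n| < tau)%R].
pose P2 := [pred p : 'I_n.+1 * 'I_n.+1 |
  (tau <= `|entry (act (inv_seq s) f - f) p|)%R].
apply: (@le_trans _ _ (#|P1|%:R + #|P2|%:R)).
  rewrite -natrD ler_nat -cardUI; apply: leq_trans (leq_addr _ _).
  apply/subset_leq_card/fintype.subsetP => -[x y]; rewrite !inE /rel_of /=.
  rewrite entryB entry_act /= /inv_seq invgK; apply: contraR.
  rewrite negb_or -!leNgt -ltNge => /andP[].
  move: (entry f _) (entry f _) (level n) => u v t.
  rewrite real_ltr_norml ?num_real// real_ler_normr ?num_real// => h1 h2.
  by apply/eqP; apply/idP/idP; lra.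
have h1 : #|P1|%:R <= n.+1%:R * (e / 2).
  have := level_sparse kn; rewrite -/P1 => h.
  have kk : k.+1%:R <= 2 ^+ k :> R by rewrite -natrX ler_nat; exact: ltn_expl.
  have : #|P1|%:R * k.+1%:R <= n.+1%:R * (9 * M) :> R.
    apply: (@le_trans _ _ (#|P1|%:R * 2 ^+ k)); first by rewrite ler_wpM2l.
    by apply: (le_trans h); rewrite ler_wpM2l// ler_wpM2l.
  rewrite -ler_pdivlMr ?ltr0n// => /le_trans; apply; rewrite -mulrA ler_wpM2l//.
  move: ke; rewrite ltr_pdivlMr; last by lra.
  have : 0 <= k.+1%:R^-1 :> R by rewrite invr_ge0.
  move: k.+1%:R^-1 => c c0; nra.
have h2 : #|P2|%:R <= n.+1%:R * (e / 2).
  have := @card_entry_le n (act (inv_seq s) f - f) P2 (tau ^+ 2).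
  have h : forall p, P2 p -> tau ^+ 2 <= entry (act (inv_seq s) f - f) p ^+ 2.
    by move=> p /= tp; rewrite -[leRHS]real_normK ?num_real// lerXn2r// nnegrE// ltW.
  move=> /(_ h); rewrite -ler_pdivlMr ?exprn_gt0// => /le_trans; apply.
  rewrite -mulrA ler_wpM2l// ler_pdivrMr ?exprn_gt0//.
  by rewrite [leRHS]mulrC ltW.
by rewrite -[e in leRHS](divfK (_ : 2 != 0))// mulr_natr mulr2n mulrDr lerD.
Qed.

Lemma rounding : exists d', (forall s, Gam s ->
  dist (mul_seq s d') (mul_seq d' s) = 0) /\ dist d d' <= 18 * r.
Proof.
exists rounded; split; last exact: rounded_close.
move=> s Gs; apply: dist_seq_eq0 => e e0.
have [|k ke] := @invr_small R (e / 2); first by rewrite divr_gt0.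
pose K : R := k.+1%:R.
have K0 : 0 < K by rewrite ltr0n.
have K3 : 0 < 3 + 3 * K by lra.
have e' : 0 < e / 2 / (3 + 3 * K) by rewrite !divr_gt0.
apply: filterS (rel_of_discrepancy Gs e') => n.
have := round_perm_equivariant (@rel_of n) (s n) k.+1.
rewrite card_ord -(ler_nat R) natrD !natrM natrD !natrM -/K.
set D : R := #|discrepancy _ _|%:R.
rewrite /hamming (_ : #|[pred x | mul_seq s rounded n x != mul_seq rounded s n x]| =
  #|[pred x | round_perm (@rel_of n) (s n x) != s n (round_perm (@rel_of n) x)]|); last first.
  by apply: eq_card => x; rewrite !inE /mul_seq !permM eq_sym.
set B : R := #|_|%:R => hB hD.
have N0 : 0 < n.+1%:R :> R by rewrite ltr0n.
rewrite ler_pdivrMr//; move: hB hD N0; move: n.+1%:R => N hB.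
rewrite mulrA ler_pdivlMr// => hD N0.
have ke' : 1 < K * (e / 2) by rewrite -ltr_pdivrMl// mulr1.
rewrite -(ler_pM2l K0); apply: (le_trans hB).
have : K * (D * (3 + 3 * K)) <= K * (N * (e / 2)) by rewrite ler_pM2l.
have : N * 1 <= N * (K * (e / 2)) by rewrite ler_pM2l// ltW.
rewrite -[e in _ <= K * (e * N)](divfK (_ : 2 != 0))//.
by move: (e / 2) => c; lra.
Qed.

End Rounding.
End Graphs.

(** * Stability of commutants *)

Lemma multiplicative1 (G H : groupType) (f : {multiplicative G -> H}) : f 1%g = 1%g.
Proof. by apply: (@mulgI _ (f 1%g)); rewrite -gmulfM !mulg1. Qed.

Section Commutants.
Variables (R : realType) (U : npUltrafilter).
Implicit Types (f g : mxseq R) (s t a b d c : perm_seq).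
Local Notation uform := (@uform R U).
Local Notation tame := (@tame R U).
Local Notation dist := (dist_seq R U).
Local Notation H := (mx_hilbert R U).
Local Notation cls := (\pi_(sofic_group R U)%qT).

Lemma cls_mul s t : cls (mul_seq s t) = (cls s * cls t)%g.
Proof. by rewrite -sofic_mul_pi. Qed.

Lemma cls_eq s t : cls s = cls t <-> dist s t = 0.
Proof. exact: sofic_piP. Qed.

Lemma tame_act s f : tame f -> tame (act s f).
Proof.
move=> [bf fst]; split=> [|t t' tt']; first exact: bounded_act.
by rewrite !act_mul fst// dist_mulr.
Qed.

Definition invariant_under (Gam : set perm_seq) : set H :=
  [set w | tame w /\ forall s, Gam s -> uform (act s w - w) (act s w - w) = 0].

(** The case of [center] where the orbit is that of a graph under conjugation by
a monoid of permutation sequences. *)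
Lemma graph_center (Gam : set perm_seq) d : Gam one_seq ->
  (forall s t, Gam s -> Gam t -> Gam (mul_seq s t)) ->
  exists m, [/\ invariant_under Gam m,
    forall w, invariant_under Gam w -> uform (graph R d - m) w = 0 &
    forall r, (forall s, Gam s -> dist (mul_seq d s) (mul_seq s d) <= r) ->
      uform (graph R d - m) (graph R d - m) <= 4 * r].
Proof.
move=> G1 GM; have dd := tame_graph R U d.
have [] := @center R H ((fun s => act s : H -> H) @` Gam) _ _ _ _ _ (graph R d) dd.
- by move=> _ u [s Gs <-] du; exact: tame_act.
- by move=> _ k u v [s Gs <-] du dv; exact: act_lin.
- by move=> _ u v [s Gs <-] du dv; exact: uform_act.
- move=> _ _ [s Gs <-] [t Gt <-]; exists (mul_seq s t); first exact: GM.
  by apply/funext => u /=; rewrite act_mul.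
- by exists one_seq => //; apply/funext => u; exact: act_one.
move=> m [dm minv morth mdist]; exists m; split.
- by split=> // s Gs; apply: minv; exists s.
- by move=> w [dw winv]; apply: morth => // _ [s Gs <-]; exact: winv.
move=> r dr; rewrite (_ : 4 * r = 2 * (2 * r)); last by ring.
apply: mdist => _ [s Gs <-]; rewrite /= act_graph.
change (uform (graph R d - graph R (mul_seq s (mul_seq d (inv_seq s))))
  (graph R d - graph R (mul_seq s (mul_seq d (inv_seq s)))) <= 2 * r).
by rewrite uform_graph_sub dist_conj ler_pM2l//; exact: dr.
Qed.

(** Commuting up to e with all of Gam means that the orbit of the graph has
small diameter.  In 72 = 18 * 4, the factor 4 is that of [graph_center] and 18
is that of [rounding]. *)
Lemma commutant_stability (Gam : set perm_seq) d e : Gam one_seq ->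
  (forall s t, Gam s -> Gam t -> Gam (mul_seq s t)) ->
  (forall s, Gam s -> dist (mul_seq d s) (mul_seq s d) <= e) ->
  exists2 d', forall s, Gam s -> dist (mul_seq s d') (mul_seq d' s) = 0 &
    dist d d' <= 72 * e.
Proof.
move=> G1 GM de; have [m [[[bm _] minv] _ /(_ _ de) mdist]] := graph_center d G1 GM.
have [d' [d'G d'd]] := rounding bm minv mdist; exists d' => //.
by move: d'd; rewrite mulrA -natrM.
Qed.

End Commutants.

Section KazhdanStability.
Variables (R : realType) (U : npUltrafilter) (G : groupType).
Variable pi : {multiplicative G -> sofic_group R U}.
Implicit Types (g h : G) (s t c d : perm_seq) (u v w : mx_hilbert R U).
Local Notation uform := (@uform R U).
Local Notation tame := (@tame R U).
Local Notation dist := (dist_seq R U).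
Local Notation H := (mx_hilbert R U).
Local Notation cls := (\pi_(sofic_group R U)%qT).

Definition lift g : perm_seq := repr (pi g).

Lemma cls_lift g : cls (lift g) = pi g.
Proof. exact: reprK. Qed.

Lemma liftM g h : dist (lift (g * h)%g) (mul_seq (lift g) (lift h)) = 0.
Proof. by apply/cls_eq; rewrite cls_mul !cls_lift gmulfM. Qed.

Lemma lift1 : dist (lift 1%g) one_seq = 0.
Proof. by apply/cls_eq; rewrite cls_lift multiplicative1. Qed.

(** All representatives of the elements of [pi G], which form an exact monoid,
whereas the chosen representatives [lift g] are multiplicative only up to
distance zero. *)
Definition lifts : set perm_seq := [set s | exists g, cls s = pi g].

Lemma lifts1 : lifts one_seq.
Proof. by exists 1%g; rewrite multiplicative1. Qed.

Lemma liftsM s t : lifts s -> lifts t -> lifts (mul_seq s t).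
Proof. by move=> [g sg] [h th]; exists (g * h)%g; rewrite cls_mul sg th gmulfM. Qed.

Definition commutant : set perm_seq :=
  [set c | forall s, lifts s -> dist (mul_seq s c) (mul_seq c s) = 0].

Lemma commutantP c : commutant c <-> centralizer (range pi) (cls c).
Proof.
split=> [cc _ [g _ <-]|cc s [g sg]].
  by rewrite -cls_lift -!cls_mul; apply/esym/cls_eq/cc; exists g; exact: cls_lift.
by apply/cls_eq; rewrite !cls_mul cc//; exists g.
Qed.

(** Let m be the projection of the graph of c to the invariant matrices, and w
the difference.  Since w is orthogonal to the invariant matrices, property (T)
on their orthogonal complement forces some g in Q to move w by at least
eps times its norm; but g moves w as much as it moves the graph, which is at
most 2 e in squared norm. *)
Lemma kazhdan_stability : property_T R G -> exists Q : seq G, exists2 C : R, 0 < C &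
  forall c e, 0 <= e ->
    (forall g, g \in Q -> dist (mul_seq c (lift g)) (mul_seq (lift g) c) <= e) ->
    exists2 c', commutant c' & dist c c' <= C * e.
Proof.
case=> Q [eps [eps0 TQ]]; exists Q; exists (36 / eps ^+ 2).
  by rewrite divr_gt0// exprn_gt0.
move=> c e e0 ce; have [m [minv morth _]] := @graph_center R U lifts c lifts1 liftsM.
pose I := @invariant_under R U lifts.
have Id : I `<=` @sh_dom R H by move=> w [].
have gc := tame_graph R U c; have dm := minv.1.
pose w : H := graph R c - m.
have dw : sh_dom w := domB (gc : sh_dom (graph R c : H)) dm.
have liftI g u : I u -> uform (act (lift g) u - u) (act (lift g) u - u) = 0.
  by case=> _; apply; exists g; exact: cls_lift.
have dact g u : sh_dom u -> sh_dom (act (lift g) u : H) by exact: tame_act.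
pose W := complement Id.
have [w0|wpos] : uform w w = 0 \/ 0 < uform w w.
  have : 0 <= uform w w := sh_form_ge0 dw.
  by rewrite le_eqVlt => /orP[/eqP <-|]; [left|right].
- have [|c' [c'G c'c]] := rounding (d := c) dm.1 minv.2 (r := 0); first by rewrite w0.
  exists c' => //; apply: le_trans c'c _; rewrite mulr0 mulr_ge0// divr_ge0//.
  exact: exprn_ge0 (ltW eps0).
have [g gQ wg] : exists2 g, g \in Q &
    eps ^+ 2 * uform w w <= uform (act (lift g) w - w) (act (lift g) w - w).
  apply: contrapT => nQ.
  have [||||||g gQ|u [du upos uinv]] := @property_T_invariant R G W
    (fun g u => act (lift g) u) _ _ _ _ _ Q eps TQ eps0 w _ wpos.
  - move=> g u [du uI]; split=> [|z zI]; first exact: dact.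
    rewrite -(uI z zI) -[RHS](uform_act U (lift g)); have dz := Id _ zI.
    apply: (@null_form_eq R H) => //; try exact: dact.
      by rewrite subrr form0l//; exact: sh_dom0.
    by rewrite (@formBC R H z _ dz (dact g z dz)); exact: liftI.
  - by move=> g a u v _ _; exact: act_lin.
  - by move=> g u v _ _; exact: uform_act.
  - move=> u [[_ du] _]; have := du _ _ lift1.
    by rewrite act_one.
  - move=> g h u [[_ du] _]; have := du _ _ (liftM g h).
    by rewrite act_mul.
  - by split=> // z zI; exact: morth.
  - rewrite ltNge; apply/negP => wg; apply: nQ; by exists g.
  have uI : I u.
    split; first exact: du.1.
    move=> s [g sg].
    have su : uform (act s u - act (lift g) u) (act s u - act (lift g) u) = 0.
      by apply: (du.1.2); apply/cls_eq; rewrite cls_lift.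
    have gu : uform (act (lift g) u - u) (act (lift g) u - u) = 0 := uinv g.
    have := @null_trans R H (act (lift g) u) (act s u) u.
    by apply=> //; [exact: tame_act du.1|exact: dact du.1|exact: du.1].
  have u0 : sh_form (u : W) u = 0 := du.2 u uI.
  by move: upos; rewrite u0 ltxx.
have bw : sh_form w w <= 2 * e / eps ^+ 2.
  rewrite ler_pdivlMr ?exprn_gt0// mulrC; apply: le_trans wg _.
  have dgm := dact g m dm; have dgc := dact g (graph R c) gc.
  have wE : act (lift g) w - w =
      act (lift g) (graph R c) - graph R c + (m - act (lift g) m).
    by rewrite /w actB opprB [m - graph R c]addrC addrACA [m - _]addrC.
  have da := domB dgc gc; have db := domB (dm : sh_dom (m : H)) dgm.
  have b0 : sh_form (m - act (lift g) m : H) (m - act (lift g) m) = 0.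
    by rewrite (formBC (dm : sh_dom (m : H)) dgm); exact: liftI.
  rewrite wE; change (sh_form (act (lift g) (graph R c) - graph R c + (m - act (lift g) m) : H)
    (act (lift g) (graph R c) - graph R c + (m - act (lift g) m)) <= 2 * e).
  rewrite (formD2 da db) (null_forml da db b0) b0 mulr0 !addr0.
  change (uform (act (lift g) (graph R c) - graph R c)
    (act (lift g) (graph R c) - graph R c) <= 2 * e).
  rewrite uformBC act_graph uform_graph_sub dist_conj ler_pM2l//; exact: ce.
have [c' [c'G c'c]] := rounding (d := c) dm.1 minv.2 bw.
exists c' => //; apply: le_trans c'c _; rewrite le_eqVlt; apply/orP; left; apply/eqP.
by field; rewrite gt_eqF.
Qed.

End KazhdanStability.

(** * The zero-one law *)

Section ZeroOne.
Variables (R : realType) (U : npUltrafilter).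
Local Notation dist := (dist_seq R U).
Local Notation cls := (\pi_(sofic_group R U)%qT).

Lemma internal_act (a : sofic_group R U) (Y : forall n, {set 'I_n.+1}) :
  loeb_act a @` internal U Y = internal U (fun n => (repr a n @: Y n)%SET).
Proof.
apply/seteqP; split=> [_ [y + <-]|y].
  rewrite -{1}[y]reprK => /internal_pi yY; apply/internal_pi.
  by apply: filterS yY => n yY; exact: imset_f.
rewrite -{1}[y]reprK => /internal_pi ya.
pose z : point_seq := fun n => ((repr a n)^-1)%g (repr y n).
exists (\pi_(loeb_space U)%qT z).
  apply/internal_pi; apply: filterS ya => n /imsetP[x xY yE].
  by rewrite /z yE permK.
rewrite /loeb_act -[y in RHS]reprK; apply/loeb_piP.
have /loeb_piP zE : \pi_(loeb_space U)%qT (repr (\pi_(loeb_space U)%qT z)) =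
    \pi_(loeb_space U)%qT z by rewrite reprK.
by apply: filterS zE => n ->; rewrite /z permKV.
Qed.

Lemma internal_symdiff (Y Z : forall n, {set 'I_n.+1}) :
  internal U Y `+` internal U Z =
  internal U (fun n => (Y n :\: Z n :|: Z n :\: Y n)%SET).
Proof.
rewrite /setY !setDE !internalC.
have I (A B : forall n, {set 'I_n.+1}) :
    internal U A `&` internal U B = internal U (fun n => (A n :&: B n)%SET).
  rewrite -[LHS]setCK setCI !internalC internalU internalC.
  congr internal; apply: functional_extensionality_dep => n.
  by rewrite finset.setCU !finset.setCK.
rewrite !I internalU; congr internal; apply: functional_extensionality_dep => n.
by rewrite !finset.setDE.
Qed.

(** If a commutes with d at x, then x is fixed by d if and only if its image
under a is.  So the internal set of the fixed points of d is A-invariant modulo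
null sets, and its density is 1 - dist d 1. *)
Lemma zero_one (A : set (sofic_group R U)) (d : perm_seq) : acts_ergodically A ->
  (forall a, A (cls a) -> dist (mul_seq d a) (mul_seq a d) = 0) ->
  dist d one_seq = 0 \/ dist d one_seq = 1.
Proof.
move=> ergA dA; pose Y n : {set 'I_n.+1} := [set x | d n x == x]%SET.
have YE : density R U Y = 1 - dist d one_seq.
  apply/eqP; rewrite -subr_eq opprK; apply/eqP.
  rewrite /dist_seq -(ulimD U (density_bnd R Y) (fun n => hamming_bnd R (d n) (one_seq n))).
  apply: ulim_near; near=> n; rewrite /hamming -mulrDl -natrD.
  rewrite (_ : #|[pred x | d n x != one_seq n x]| = #|~: Y n|%SET).
    by rewrite finset.cardsC card_ord divff// pnatr_eq0.
  by apply: eq_card => x; rewrite !inE perm1.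
have [| |h|h] := ergA (internal U Y).
- exact: loeb_measurable_internal.
- move=> a Aa; rewrite internal_act internal_symdiff loeb_measure_internal; congr EFin.
  have Zb := density_bnd R
    (fun n => ((repr a n @: Y n) :\: Y n :|: Y n :\: (repr a n @: Y n))%SET).
  apply/eqP; rewrite eq_le; apply/andP; split; last exact: (ulim_ge0 U Zb).
  have da : dist (mul_seq d (repr a)) (mul_seq (repr a) d) = 0.
    by apply: dA; rewrite reprK.
  rewrite -da; apply: (ulim_le Zb (fun n => hamming_bnd _ _ _)).
  near=> n; rewrite /hamming ler_wpM2r ?invr_ge0// ler_nat.
  rewrite -(card_imset _ (@perm_inj _ (repr a n)^-1%g)).
  apply/subset_leq_card/fintype.subsetP => _ /imsetP[x + ->]; rewrite !inE => xY.
  rewrite /mul_seq !permM permKV; apply: contraTN xY => /eqP dx.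
  have -> : (x \in (repr a n @: Y n)%SET) = (d n x == x).
    apply/imsetP/eqP => [[y]|dxx]; last first.
      exists (((repr a n)^-1)%g x); last by rewrite permKV.
      by rewrite inE -(inj_eq (@perm_inj _ (repr a n))) -dx permKV dxx.
    by rewrite inE => /eqP dy xy; rewrite dx xy permK dy.
  by case: eqP.
- by move: h; rewrite loeb_measure_internal YE => -[h]; right; lra.
by move: h; rewrite loeb_measure_internal YE => -[h]; left; lra.
Unshelve. all: by end_near. Qed.

End ZeroOne.

(** * Local embeddings from separated families of permutations *)

(** [dichotomy] makes [h d d' < 1 / 8] an equivalence relation on L, and by
[absorb] left multiplication by [sigma g] acts on the classes.  The bounds 1/8
and 7/8 leave room for the seven errors of size 1/8 that multiplicativity
accumulates. *)
Section LocalEmbedding.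
Variables (R : realType) (G : groupType) (n : nat).
Local Notation P := {perm 'I_n}.
Local Notation h := (@hamming R n).
Variables (L : pred P) (sigma : G -> P) (E : set G).
Implicit Types (d e : P) (g k : G).
Hypothesis L1 : L 1%g.
Hypothesis dichotomy : forall d d', L d -> L d' -> h d d' < 1 / 8 \/ 7 / 8 < h d d'.
Hypothesis absorb : forall g d, E g -> L d ->
  exists2 d', L d' & h (d * sigma g)%g d' < 1 / 8.
Hypothesis sigmaM : forall g k, E g -> E k -> E (g * k)%g ->
  h (sigma (g * k)%g) (sigma k * sigma g)%g < 1 / 8.
Hypothesis sigma_inj : forall g k, E g -> E k -> g <> k -> 7 / 8 < h (sigma g) (sigma k).

Let near_eq d d' : L d -> L d' -> h d d' < 7 / 8 -> h d d' < 1 / 8.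
Proof. by move=> Ld Ld' dd'; case: (dichotomy Ld Ld'); lra. Qed.

(** With radius 1/2 the representative is also that of the class of d when e is
outside L and only close to an element d of L. *)
Definition representative e : P := odflt 1%g [pick d | L d && (h e d < 1 / 2)].
Local Notation rep := representative.

Let rep_eq e d : L d -> h e d < 1 / 8 -> rep e = rep d.
Proof.
move=> Ld ed; congr odflt; apply: eq_pick => d' /=; case Ld' : (L d') => //=.
apply/idP/idP => ed'.
  have := hamming_triangle R e d d'; rewrite (hammingC R d e) => t1.
  by have := near_eq Ld Ld'; lra.
have := hamming_triangle R d e d' => t1.
by have := near_eq Ld Ld'; lra.
Qed.

Let repP d : L d -> L (rep d) /\ h d (rep d) < 1 / 8.
Proof.
move=> Ld; rewrite /representative; case: pickP => /= [d' /andP[Ld' dd']|/(_ d)].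
  by split=> //; apply: near_eq => //; lra.
by rewrite Ld hammingxx; lra.
Qed.

Let repK d : L d -> rep (rep d) = rep d.
Proof. by move=> Ld; have [Lr dr] := repP Ld; apply: rep_eq; rewrite // hammingC. Qed.

Definition rep_set := {d : P | L d && (rep d == d)}.
HB.instance Definition _ := Finite.on rep_set.
Implicit Types x y : rep_set.

Definition translate g x : rep_set := insubd x (rep (val x * sigma g)%g).

Let translateP g x : E g -> h (val x * sigma g)%g (val (translate g x)) < 1 / 4.
Proof.
move=> Eg; have /andP[Lx _] := valP x; have [d Ld xd] := absorb Eg Lx.
have [Lr dr] := repP Ld; rewrite /translate val_insubd (rep_eq Ld xd) Lr repK// eqxx /=.
by have := hamming_triangle R d (val x * sigma g)%g (rep d); lra.
Qed.

Let rep_set_eq x y : h (val x) (val y) < 7 / 8 -> x = y.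
Proof.
have /andP[Lx /eqP rx] := valP x; have /andP[Ly /eqP ry] := valP y.
by move=> /(near_eq Lx Ly) /(rep_eq Ly); rewrite rx ry => /val_inj.
Qed.

Let translate_inj g : E g -> injective (translate g).
Proof.
move=> Eg x y xy; apply: rep_set_eq; rewrite -(hamming_mulr R (sigma g)).
have := translateP x Eg; have := translateP y Eg; rewrite xy.
have := hamming_triangle R (val (translate g y)) (val x * sigma g)%g (val y * sigma g)%g.
rewrite (hammingC R (val (translate g y)) (val y * _)%g); lra.
Qed.

(** The inverse turns the action on classes into a homomorphism, as products of
permutations are read from left to right. *)
Definition local_hom g : {perm rep_set} :=
  (odflt 1 [pick u : {perm rep_set} | [forall x, u x == translate g x]])^-1%g.

Let local_homE g x : E g -> (local_hom g)^-1%g x = translate g x.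
Proof.
move=> Eg; rewrite /local_hom invgK; case: pickP => [u /forallP/(_ x)/eqP //|].
move=> /(_ (perm (translate_inj Eg))) /forallP[] y; by rewrite permE.
Qed.

Lemma local_embedding : exists (K : finGroupType) (theta : G -> K),
  {in E &, injective theta} /\
  forall g k, E g -> E k -> E (g * k)%g -> theta (g * k)%g = (theta g * theta k)%g.
Proof.
exists {perm rep_set}, local_hom; split=> [g k|g k Eg Ek Egk].
  rewrite !inE => Eg Ek gk; apply: contrapT => /(sigma_inj Eg Ek) sgk.
  have r1 : L (rep 1%g) && (rep (rep 1%g) == rep 1%g).
    by apply/andP; split; [case: (repP L1) | apply/eqP; exact: (repK L1)].
  have [x _] : exists x : rep_set, True by exists (exist _ (rep 1%g) r1).
  have xgk : translate g x = translate k x.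
    by rewrite -(local_homE x Eg) -(local_homE x Ek) gk.
  have := translateP x Eg; have := translateP x Ek; rewrite xgk.
  move: sgk; rewrite -(hamming_mull R (val x)); move: (val (translate k x)) => y.
  have := hamming_triangle R y (val x * sigma g)%g (val x * sigma k)%g.
  rewrite (hammingC R y); lra.
suff lM : ((local_hom (g * k)%g)^-1 = (local_hom k)^-1 * (local_hom g)^-1)%g.
  by apply: invg_inj; rewrite invMg.
apply/perm.permP => x; rewrite (permM (local_hom k)^-1%g (local_hom g)^-1%g).
apply: (etrans (local_homE x Egk)).
apply: (etrans _ (esym (etrans (congr1 _ (local_homE x Ek)) (local_homE _ Eg)))).
apply: rep_set_eq.
have := translateP x Egk; have := translateP x Ek; have := translateP (translate k x) Eg.
move: (val (translate g _)) (val (translate k x)) (val (translate (g * k)%g x)) => a b c.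
rewrite -(hamming_mulr R (sigma g) (val x * sigma k)%g).
have := sigmaM Eg Ek Egk; rewrite -(hamming_mull R (val x)) mulgA.
move: (val x * sigma (g * k))%g (val x * _ * _)%g (b * _)%g => u v w.
have := hamming_triangle R u c a; have := hamming_triangle R v u a.
have := hamming_triangle R w v a; rewrite (hammingC R c u); lra.
Qed.

End LocalEmbedding.

(** * Kazhdan groups with ergodic centralizer *)

Section NearQuantifiers.
Variable U : npUltrafilter.

(** Transfer: an internal property that holds along all sequences holds
uniformly at almost all indices. *)
Lemma near_forall (T : nat -> Type) (x0 : forall n, T n) (P : forall n, T n -> Prop) :
  (forall x : forall n, T n, \forall n \near ufilter U, P n (x n)) ->
  \forall n \near ufilter U, forall x, P n x.
Proof.
move=> Px; apply: contrapT => /ufN nP.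
pose x n := if pselect (exists y, ~ P n y) is left e then sval (cid e) else x0 n.
apply: (@filter_not_empty _ (ufilter U)).
apply: filterS2 nP (Px x) => n /existsNP nPn.
by rewrite /x; case: pselect => // e; case: cid.
Qed.

(** For an ultrafilter, either A holds at almost all indices or it
fails at almost all indices. *)
Lemma near_imply (A B : set nat) :
  (ufilter U A -> ufilter U B) -> \forall n \near ufilter U, A n -> B n.
Proof.
move=> AB; case: (@in_ultra_setVsetC _ (ufilter U) A _) => [/AB|].
  by apply: filterS.
by apply: filterS => n nA /nA.
Qed.

Lemma near_forall_finite (T : choiceType) (E : set T) (P : nat -> T -> Prop) : finite_set E ->
  (forall x, E x -> \forall n \near ufilter U, P n x) ->
  \forall n \near ufilter U, forall x, E x -> P n x.
Proof.
move=> /finite_seqP[s ->]; elim: s => [|y s IH] Ps; first by near=> n.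
have /IH : forall x, [set` s] x -> \forall n \near ufilter U, P n x.
  by move=> x xs; apply: Ps; rewrite /= inE xs orbT.
have /Ps Py : [set` y :: s] y by rewrite /= inE eqxx.
apply: filterS2 Py => n Py Pn x.
by rewrite /= inE => /orP[/eqP ->|/Pn].
Unshelve. all: by end_near. Qed.

End NearQuantifiers.

Section KazhdanLEF.
Variables (R : realType) (U : npUltrafilter) (G : groupType).
Variable pi : {multiplicative G -> sofic_group R U}.
Hypothesis kazhdan : property_T R G.
Hypothesis embedding : sofic_embedding pi.
Hypothesis ergodic : acts_ergodically (centralizer (range pi)).
Implicit Types (g h : G) (s t c d : perm_seq).
Local Notation dist := (dist_seq R U).
Local Notation cls := (\pi_(sofic_group R U)%qT).
Local Notation lift := (lift pi).
Local Notation commutant := (commutant pi).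

Definition bicommutant : set perm_seq :=
  [set d | forall c, commutant c -> dist (mul_seq c d) (mul_seq d c) = 0].

Lemma bicommutantP d : bicommutant d <->
  forall a, centralizer (range pi) a -> commute a (cls d).
Proof.
split=> [dd a ca|dd c /commutantP cc]; last first.
  by apply/cls_eq; rewrite !cls_mul; exact: dd.
rewrite /commute -[a]reprK -!cls_mul; apply/cls_eq/dd/commutantP.
by rewrite reprK.
Qed.

Lemma commutant1 : commutant one_seq.
Proof. by apply/commutantP => a _; rewrite mulg1 mul1g. Qed.

Lemma commutantM s t : commutant s -> commutant t -> commutant (mul_seq s t).
Proof.
move=> /commutantP cs /commutantP ct; apply/commutantP => a ra.
by rewrite cls_mul -mulgA ct// mulgA cs// mulgA.
Qed.

Lemma bicommutant_lift g : bicommutant (lift g).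
Proof. by apply/bicommutantP => a ca; rewrite cls_lift; apply: ca; exists g. Qed.

Lemma bicommutant_zero_one d d' : bicommutant d -> bicommutant d' ->
  dist d d' = 0 \/ dist d d' = 1.
Proof.
move=> /bicommutantP dd /bicommutantP dd'.
have -> : dist d d' = dist (mul_seq (inv_seq d) d') one_seq.
  rewrite dist_seqC -(dist_mull R U (inv_seq d)); congr (dist_seq R U).
  by apply: functional_extensionality_dep => n; rewrite /mul_seq /inv_seq mulgV.
apply: (zero_one ergodic) => a ca; apply/cls_eq; rewrite !cls_mul -sofic_inv_pi.
by apply/esym/commuteM; [apply: commuteV; exact: dd | exact: dd'].
Qed.

(** Small enough for 2 * 72 * eta < 1 / 8, where 72 is the constant of
[commutant_stability]. *)
Let eta : R := (40 * 40)^-1.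

Let close_to_bicommutant d (e : R) :
  (forall c, commutant c -> dist (mul_seq d c) (mul_seq c d) <= e) ->
  exists2 d', bicommutant d' & dist d d' <= 72 * e.
Proof. exact: commutant_stability commutant1 commutantM. Qed.

(** With e = eta / (4 C), elements of A are (eta / 4)-close to the commutant, so
elements of the bicommutant commute with them up to eta / 2 and lie in L; and
elements of L commute up to eta with the commutant, so they are close to the
bicommutant, where distances are 0 or 1. *)
Lemma LEF_of_ergodic : LEF G.
Proof.
have [Q [C C0 stab]] := kazhdan_stability pi kazhdan.
have eta0 : 0 < eta by rewrite invr_gt0.
pose e := eta / (4 * C).
have e0 : 0 < e by rewrite divr_gt0// mulr_gt0.
pose A n : pred {perm 'I_n.+1} := fun c : {perm 'I_n.+1} =>
  all (fun g => hamming R (lift g n * c)%g (c * lift g n)%g <= e) Q.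
pose L n : pred {perm 'I_n.+1} := fun d : {perm 'I_n.+1} =>
  [forall c : {perm 'I_n.+1}, A n c ==> (hamming R (d * c)%g (c * d)%g <= eta)].
have A_close c : (\forall n \near ufilter U, A n (c n)) ->
    exists2 c', commutant c' & dist c c' <= eta / 4.
  move=> Ac; have [|c' cc' c'c] := stab c e (ltW e0).
    move=> g gQ; apply: (@ulim_le_near _ _ _ 0 1) => [n|]; first exact: hamming_bnd.
    by apply: filterS Ac => n /allP/(_ g gQ).
  exists c' => //; apply: le_trans c'c _; rewrite /e.
  by rewrite (_ : C * _ = eta / 4)//; field; rewrite gt_eqF.
have A_commutant c : commutant c -> \forall n \near ufilter U, A n (c n).
  move=> cc; have : \forall n \near ufilter U, forall g, [set` Q] g ->
      hamming R (lift g n * c n)%g (c n * lift g n)%g < e.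
    apply: near_forall_finite; first exact: finite_seq.
    move=> g gQ; apply: (@near_ulim_lt _ _ _ 0 1) => [n|]; first exact: hamming_bnd.
    have := cc (lift g) (ex_intro _ g (cls_lift pi g)).
    by rewrite dist_seqC /dist_seq /mul_seq => ->.
  by apply: filterS => n h; apply/allP => g gQ; apply/ltW/h.
have L_comm d c : (\forall n \near ufilter U, L n (d n)) -> commutant c ->
    dist (mul_seq d c) (mul_seq c d) <= eta.
  move=> Ld /A_commutant Ac; rewrite dist_seqC.
  apply: (@ulim_le_near _ _ _ 0 1) => [n|]; first exact: hamming_bnd.
  by apply: filterS2 Ld Ac => n /forallP/(_ (c n))/implyP.
have L_bicommutant d : bicommutant d -> \forall n \near ufilter U, L n (d n).
  move=> dd; have : \forall n \near ufilter U, forall c : {perm 'I_n.+1},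
      A n c -> hamming R (d n * c)%g (c * d n)%g <= eta.
    apply: near_forall => [n|c]; first exact: 1%g.
    apply: near_imply => /A_close[c' cc' c'c].
    have : dist (mul_seq c d) (mul_seq d c) < eta.
      have := dist_seq_triangle R U (mul_seq c' d) (mul_seq c d) (mul_seq d c).
      have := dist_seq_triangle R U (mul_seq d c') (mul_seq c' d) (mul_seq d c).
      rewrite dd// dist_mulr dist_mull (dist_seqC R U c'); lra.
    move/(near_ulim_lt (fun n => hamming_bnd R _ _)).
    by apply: filterS => n /ltW.
  by apply: filterS => n h; apply/forallP => c; apply/implyP => /h.
have near_L d : (\forall n \near ufilter U, L n (d n)) ->
    exists2 d', bicommutant d' & dist d d' <= 72 * eta.
  by move=> Ld; apply: close_to_bicommutant => c; exact: L_comm.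
have dichotomy : \forall n \near ufilter U, forall dd : {perm 'I_n.+1} * {perm 'I_n.+1},
    L n dd.1 -> L n dd.2 -> hamming R dd.1 dd.2 < 1 / 8 \/ 7 / 8 < hamming R dd.1 dd.2.
  apply: near_forall => [n|x]; first exact: (1%g, 1%g).
  apply: near_imply => L1; apply: near_imply => L2.
  pose d : perm_seq := fun n => (x n).1; pose d' : perm_seq := fun n => (x n).2.
  have [b bb db] := near_L d L1; have [b' bb' db'] := near_L d' L2.
  have hb n := hamming_bnd R (d n) (d' n).
  have t1 := dist_seq_triangle R U b d d'; have t2 := dist_seq_triangle R U b' b d'.
  have t3 := dist_seq_triangle R U d b b'; have t4 := dist_seq_triangle R U d' d b'.
  rewrite (dist_seqC R U b' d') in t2; rewrite (dist_seqC R U b d) in t3.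
  have [bz|bo] := bicommutant_zero_one bb bb'.
    have /(near_ulim_lt hb) : dist d d' < 1 / 8 by move: db db'; rewrite /eta; lra.
    by apply: filterS => n; left.
  have /(near_ulim_gt hb) : 7 / 8 < dist d d' by move: db db'; rewrite /eta; lra.
  by apply: filterS => n; right.
have absorb g : \forall n \near ufilter U, forall d : {perm 'I_n.+1}, L n d ->
    exists2 d', L n d' & hamming R (d * lift g n)%g d' < 1 / 8.
  apply: near_forall => [n|d]; first exact: 1%g.
  apply: near_imply => Ld.
  have [d' bd' dd'] : exists2 d', bicommutant d' &
      dist (mul_seq (lift g) d) d' <= 72 * eta.
    apply: close_to_bicommutant => c cc; have := L_comm d c Ld cc.
    have := dist_seq_triangle R U (mul_seq (lift g) (mul_seq c d))
      (mul_seq (lift g) (mul_seq d c)) (mul_seq c (mul_seq (lift g) d)).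
    rewrite dist_mull.
    have A3 a b b' : mul_seq a (mul_seq b b') = mul_seq (mul_seq a b) b'.
      by apply: functional_extensionality_dep => n; rewrite /mul_seq mulgA.
    have := bicommutant_lift g cc; rewrite dist_seqC -(dist_mulr R U d) -!A3 => ->.
    by rewrite addr0; exact: le_trans.
  have : dist (mul_seq (lift g) d) d' < 1 / 8 by move: dd'; rewrite /eta; lra.
  move/(near_ulim_lt (fun n => hamming_bnd R _ _)).
  apply: filterS2 (L_bicommutant _ bd') => n Ld' h; by exists (d' n).
have multiplicative g k : \forall n \near ufilter U,
    hamming R (lift (g * k)%g n) (lift k n * lift g n)%g < 1 / 8.
  apply: (@near_ulim_lt _ _ _ 0 1) => [n|]; first exact: hamming_bnd.
  by have := liftM pi g k; rewrite /dist_seq /mul_seq => ->; lra.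
have separated g k : g <> k -> \forall n \near ufilter U,
    7 / 8 < hamming R (lift g n) (lift k n).
  move=> gk; apply: (@near_ulim_gt _ _ _ 0 1) => [n|]; first exact: hamming_bnd.
  change (7 / 8 < dist (lift g) (lift k)).
  have [d0|->] := bicommutant_zero_one (bicommutant_lift g) (bicommutant_lift k); last by lra.
  have gk1 : (g^-1 * k)%g <> 1%g.
    by move=> gk1; apply: gk; rewrite -[k](mulKVg g) gk1 mulg1.
  have /cls_eq := d0; rewrite !cls_lift => pgk.
  have := embedding gk1; rewrite gmulfM -pgk -gmulfM mulVg multiplicative1.
  rewrite /sofic_dist dist_seqxx; lra.
move=> E finE.
have all1 : \forall n \near ufilter U, forall g, E g -> forall d : {perm 'I_n.+1}, L n d ->
    exists2 d', L n d' & hamming R (d * lift g n)%g d' < 1 / 8.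
  by apply: near_forall_finite => // g _; exact: absorb.
have all2 : \forall n \near ufilter U, forall g, E g -> forall k, E k ->
    hamming R (lift (g * k)%g n) (lift k n * lift g n)%g < 1 / 8.
  by apply: near_forall_finite => // g _; apply: near_forall_finite.
have all3 : \forall n \near ufilter U, forall g, E g -> forall k, E k ->
    g <> k -> 7 / 8 < hamming R (lift g n) (lift k n).
  apply: near_forall_finite => // g _; apply: near_forall_finite => // k _.
  have [->|/eqP gk] := eqVneq g k; first by apply: nearW.
  by apply: filterS (separated _ _ gk).
have [n [[H1 H2] [H3 H4]]] : exists n, ((forall dd : {perm 'I_n.+1} * {perm 'I_n.+1},
    L n dd.1 -> L n dd.2 -> hamming R dd.1 dd.2 < 1 / 8 \/ 7 / 8 < hamming R dd.1 dd.2) /\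
    (forall g, E g -> forall d : {perm 'I_n.+1}, L n d ->
    exists2 d', L n d' & hamming R (d * lift g n)%g d' < 1 / 8)) /\
    ((forall g, E g -> forall k, E k ->
    hamming R (lift (g * k)%g n) (lift k n * lift g n)%g < 1 / 8) /\
    (forall g, E g -> forall k, E k ->
    g <> k -> 7 / 8 < hamming R (lift g n) (lift k n))).
  apply: (@filter_ex _ (ufilter U)).
  by apply: filterI; apply: filterI.
apply: (@local_embedding R G n.+1 (L n) (fun g => lift g n) E).
- apply/forallP => c; apply/implyP => _; rewrite mulg1 mul1g hammingxx; exact: ltW.
- by move=> d d' Ld Ld'; exact: (H1 (d, d')).
- by move=> g d Eg; exact: H2.
- by move=> g k Eg Ek _; exact: H3.
- by move=> g k Eg Ek; exact: H4.
Qed.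

End KazhdanLEF.

(** * Finite presentation *)

Section FinitePresentation.
Implicit Types G H : groupType.

Lemma eval_word_cat H n (gen : 'I_n -> H) (u v : word n) :
  eval_word gen (u ++ v) = (eval_word gen u * eval_word gen v)%g.
Proof. exact: big_cat. Qed.

Lemma eval_word_nil H n (gen : 'I_n -> H) : eval_word gen [::] = 1%g.
Proof. exact: big_nil. Qed.

Lemma eval_word_cons H n (gen : 'I_n -> H) (l : 'I_n * bool) (u : word n) :
  eval_word gen (l :: u) = (eval_word gen [:: l] * eval_word gen u)%g.
Proof. by rewrite -cat1s eval_word_cat. Qed.

Lemma eval_word_letter H n (gen : 'I_n -> H) i b :
  eval_word gen [:: (i, b)] = if b then (gen i)^-1%g else gen i.
Proof. exact: big_seq1. Qed.

(** Words that are equal in the presented group have equal values under any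
assignment of the generators that kills the relators. *)
Lemma eval_word_presentation H n (gen : 'I_n -> H) (rels : seq (word n)) :
  (forall r, r \in rels -> eval_word gen r = 1%g) ->
  forall u v, presentation_eq rels u v -> eval_word gen u = eval_word gen v.
Proof.
move=> rels1 u v; elim=> //.
- by move=> a b c _ -> _ ->.
- by move=> a a' b b' _ aa' _ bb'; rewrite !eval_word_cat aa' bb'.
- move=> i b; rewrite eval_word_cons !eval_word_letter eval_word_nil.
  by case: b; rewrite ?mulVg ?mulgV.
by move=> r /rels1 ->; rewrite eval_word_nil.
Qed.

(** A local embedding theta of the set of the values of all suffixes of the
relators, and of a word for g, commutes with the evaluation of these words.
The images of the generators thus satisfy the relations, and the induced
homomorphism does not kill g because theta is injective. *)
Lemma LEF_residually_finite G : LEF G -> finitely_presented G -> residually_finite G.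
Proof.
move=> lef [n [rels [gen [surj pres]]]] g g1.
have [w wg] := surj g.
(* Their suffixes put 1, the generators and their inverses into the set. *)
pose cancel_words : seq (word n) :=
  [seq [:: (l.1, l.2); (l.1, ~~ l.2)] | l <- enum [set: 'I_n * bool]%SET].
pose W : seq (word n) := w :: rels ++ cancel_words.
pose s := flatten [seq [seq eval_word gen (drop k u) | k <- iota 0 (size u).+1] | u <- W].
have sW u k : u \in W -> eval_word gen (drop k u) \in s.
  move=> uW; apply/flatten_mapP; exists u => //.
  have [ku|uk] := leqP k (size u).
    by apply/mapP; exists k; rewrite ?mem_iota ?add0n ?ltnS.
  apply/mapP; exists (size u); first by rewrite mem_iota add0n leqnn.
  by rewrite drop_size drop_oversize// ltnW.
have cancelW i b : [:: (i, b); (i, ~~ b)] \in W.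
  rewrite inE mem_cat; apply/orP; right; apply/orP; right.
  by apply/mapP; exists (i, b) => //; rewrite mem_enum inE.
have s_letter i b : eval_word gen [:: (i, b)] \in s.
  by have := sW _ 1%N (cancelW i (~~ b)); rewrite /= negbK.
have s1 : 1%g \in s.
  by have := sW w (size w) (mem_head _ _); rewrite drop_size eval_word_nil.
have [K [theta [theta_inj thetaM]]] := lef [set` s] (finite_seq s).
have theta1 : theta 1%g = 1%g.
  have := thetaM 1%g 1%g s1 s1; rewrite mulg1 => /(_ s1) h.
  by apply: (@mulgI _ (theta 1%g)); rewrite -h mulg1.
pose kgen i := theta (gen i).
have kletter l : eval_word kgen [:: l] = theta (eval_word gen [:: l]).
  case: l => i b; rewrite !eval_word_letter; case: b => //.
  have := thetaM (gen i) (gen i)^-1%g; rewrite mulgV theta1.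
  have := s_letter i false; have := s_letter i true; rewrite !eval_word_letter.
  move=> h1 h2 /(_ h2 h1 s1) h; apply: (@mulgI _ (kgen i)).
  by rewrite mulgV -h.
have ksuffix u : (forall k, eval_word gen (drop k u) \in s) ->
    eval_word kgen u = theta (eval_word gen u).
  elim: u => [_|l u IH us]; first by rewrite !eval_word_nil theta1.
  have us' k : eval_word gen (drop k u) \in s := us k.+1.
  rewrite eval_word_cons kletter IH// [in RHS]eval_word_cons thetaM//.
  - by case: l {us} => i b; exact: s_letter.
  - by have := us' 0%N; rewrite drop0.
  by have := us 0%N; rewrite drop0 eval_word_cons.
have kpres : forall u v, eval_word gen u = eval_word gen v ->
    eval_word kgen u = eval_word kgen v.
  move=> u v /pres; apply: eval_word_presentation => r rr.
  rewrite ksuffix => [|k]; last first.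
    by apply: sW; rewrite inE mem_cat rr orbT.
  by have /pres -> := pres_rel rr; rewrite eval_word_nil.
have /choice[wd wdE] := surj.
pose f x := eval_word kgen (wd x).
have fM : {morph f : x y / (x * y)%g}.
  by move=> x y; rewrite /f -eval_word_cat; apply: kpres; rewrite eval_word_cat !wdE.
pose F : {multiplicative G -> K} := HB.pack f (isMultiplicative.Build G K f fM).
exists K, F; change (f g <> 1%g); rewrite /f (kpres _ w) ?wdE// ksuffix; last first.
  by move=> k; apply: sW; exact: mem_head.
rewrite wg -theta1 => /theta_inj; rewrite !inE => h.
apply: g1; apply: h => //=.
by have := sW w 0%N (mem_head _ _); rewrite drop0 wg.
Qed.

End FinitePresentation.

Theorem theorem1 (R : realType) (G : groupType) (U : npUltrafilter)
    (pi : {multiplicative G -> sofic_group R U}) :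
  property_T R G ->
  sofic_embedding pi ->
  acts_ergodically (centralizer (range pi)) ->
  LEF G /\ (finitely_presented G -> residually_finite G).
Proof.
move=> kazhdan embedding ergodic.
have lef := LEF_of_ergodic kazhdan embedding ergodic.
by split=> // /(LEF_residually_finite lef).
Qed.
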